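(* Let $G$ be a graph with $n$ vertices. Then $G$ is outerplanar and $\alpha_{ir}(G) = 1$ if and only if $G$ is a union of vertex-disjoint cycles or a copy of one of the graphs $E_n$, $\frac{n}{2}K_2$, $K_{1,n-1}$, $K_{2,2}$, $K_2 + E_2$, and $Wd(3,\frac{n-1}{2})$ (each graph in the list being considered only for those $n$ for which it is defined).
   Context: All graphs are finite, simple, undirected and have at least one vertex. An irregular independent set of $G$ is an independent set $A$ of $G$ such that any two distinct vertices in $A$ have different degrees in $G$; $\alpha_{ir}(G)$ is the size of a largest irregular independent set of $G$. A graph is outerplanar if it has a plane drawing in which all the vertices lie on the boundary of the unbounded face. ''A copy of'' means a graph isomorphic to. $K_r$ and $E_r$ denote the complete graph and the graph with no edges on $r$ vertices, respectively; $K_{p,q}$ is the complete bipartite graph with partite sets of sizes $p$ and $q$; $sK_2$ is the vertex-disjoint union of $s$ copies of $K_2$. For vertex-disjoint graphs $G$ and $H$, the join $G+H$ is the graph with $V(G+H)=V(G) \cup V(H)$ and $E(G+H)=E(G) \cup E(H) \cup \{ \{ x,y\} : x \in V(G), y\in V(H) \}$. For $k \geq 2$ and $r \geq 2$, the $k$-windmill graph $Wd(k,r)$ is $K_1 + H$, where $H$ is a vertex-disjoint union of $r$ copies of $K_{k-1}$. *)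

(* Defs.v *)
From mathcomp Require Import all_boot all_order all_algebra.
From mathcomp Require Import all_classical all_reals all_analysis.

Set Implicit Arguments.
Unset Strict Implicit.
Unset Printing Implicit Defensive.

Import Order.TTheory GRing.Theory Num.Theory.
Import numFieldNormedType.Exports.

Record sgraph := SGraph {
  vertex :> finType;
  adj : rel vertex;
  adj_sym : symmetric adj;
  adj_irrefl : irreflexive adj }.

Arguments adj {s}.

Definition isomorphic (G H : sgraph) : Prop :=
  exists f : G -> H, bijective f /\ forall x y, adj (f x) (f y) = adj x y.

Section IrregularIndependence.
Variable G : sgraph.
Implicit Types (x y : G) (A : {set G}).

Definition degree x : nat := #|[pred y | adj x y]|.

Definition independent A : bool :=
  [forall x in A, forall y in A, ~~ adj x y].

Definition irregular A : bool :=
  [forall x in A, forall y in A, (x != y) ==> (degree x != degree y)].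

Definition alpha_ir : nat :=
  \max_(A : {set G} | independent A && irregular A) #|A|.

End IrregularIndependence.

Section Complete.
Variable r : nat.
Definition complete_adj : rel 'I_r := fun i j => i != j.
Lemma complete_sym : symmetric complete_adj.
Proof. by move=> i j; rewrite /complete_adj eq_sym. Qed.
Lemma complete_irrefl : irreflexive complete_adj.
Proof. by move=> i; rewrite /complete_adj eqxx. Qed.
Definition complete_graph := SGraph complete_sym complete_irrefl.
End Complete.

Section Edgeless.
Variable r : nat.
Definition edgeless_adj : rel 'I_r := fun _ _ => false.
Lemma edgeless_sym : symmetric edgeless_adj. Proof. by []. Qed.
Lemma edgeless_irrefl : irreflexive edgeless_adj. Proof. by []. Qed.
Definition edgeless_graph := SGraph edgeless_sym edgeless_irrefl.
End Edgeless.

Section CompleteBipartite.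
Variables p q : nat.
Definition bipartite_adj : rel ('I_p + 'I_q)%type := fun u v =>
  match u, v with
  | inl _, inr _ | inr _, inl _ => true
  | _, _ => false
  end.
Lemma bipartite_sym : symmetric bipartite_adj. Proof. by case=> ? [] ?. Qed.
Lemma bipartite_irrefl : irreflexive bipartite_adj. Proof. by case. Qed.
Definition complete_bipartite_graph := SGraph bipartite_sym bipartite_irrefl.
End CompleteBipartite.

(* The cycle of length m when m >= 3; the clause [i != j] only matters for
   m = 1, where [ordS] would create a loop. *)
Section Cycle.
Variable m : nat.
Definition cycle_adj : rel 'I_m :=
  fun i j => (i != j) && ((j == ordS i) || (i == ordS j)).
Lemma cycle_sym : symmetric cycle_adj.
Proof. by move=> i j; rewrite /cycle_adj eq_sym orbC. Qed.
Lemma cycle_irrefl : irreflexive cycle_adj.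
Proof. by move=> i; rewrite /cycle_adj eqxx. Qed.
Definition cycle_graph := SGraph cycle_sym cycle_irrefl.
End Cycle.

Section Join.
Variables G H : sgraph.
Definition join_adj : rel (G + H)%type := fun u v =>
  match u, v with
  | inl x, inl y => adj x y
  | inr x, inr y => adj x y
  | _, _ => true
  end.
Lemma join_sym : symmetric join_adj.
Proof. by case=> x [] y //=; rewrite adj_sym. Qed.
Lemma join_irrefl : irreflexive join_adj.
Proof. by case=> x /=; rewrite adj_irrefl. Qed.
Definition join_graph := SGraph join_sym join_irrefl.
End Join.

Section DisjointUnion.
Variables (I : finType) (H : I -> sgraph).
(* [tagged_as u v] is [tagged v] transported to the component of [u]. *)
Definition dunion_adj : rel {i : I & H i} := fun u v =>
  (tag u == tag v) && adj (tagged u) (tagged_as u v).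
Lemma dunion_sym : symmetric dunion_adj.
Proof.
move=> [i x] [j y]; rewrite /dunion_adj /= eq_sym.
by case: eqVneq y => [->|//] y; rewrite !tagged_asE adj_sym.
Qed.
Lemma dunion_irrefl : irreflexive dunion_adj.
Proof. by move=> [i x]; rewrite /dunion_adj tagged_asE adj_irrefl andbF. Qed.
Definition dunion_graph := SGraph dunion_sym dunion_irrefl.
End DisjointUnion.

Definition copies (s : nat) (H : sgraph) : sgraph :=
  dunion_graph (fun _ : 'I_s => H).

Definition windmill (k r : nat) : sgraph :=
  join_graph (complete_graph 1) (copies r (complete_graph k.-1)).

Definition disjoint_union_of_cycles (G : sgraph) : Prop :=
  exists (t : nat) (m : 'I_t -> nat),
    (forall i, 3 <= m i) /\
    isomorphic G (dunion_graph (fun i => cycle_graph (m i))).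

Local Open Scope classical_set_scope.
Local Open Scope ring_scope.

Section Outerplanar.
Variable R : realType.
Notation plane := (R * R)%type.

Definition is_arc (a b : plane) (A : set plane) : Prop :=
  exists gamma : R -> plane,
    [/\ {within `[0, 1], continuous gamma},
        {in `[0, 1] &, injective gamma},
        gamma 0 = a, gamma 1 = b & gamma @` `[0, 1] = A].

(* [edge_arc x y] is the closed arc representing the edge xy, hence contains its
   end points; its value is irrelevant when x and y are not adjacent. By
   [edge_arc_vertex], the points allowed by [edge_arc_cross] are common end
   vertices. *)
Record plane_drawing (G : sgraph) := PlaneDrawing {
  vertex_pt : G -> plane;
  edge_arc : G -> G -> set plane;
  vertex_pt_inj : injective vertex_pt;
  edge_arcC : forall x y, adj x y -> edge_arc x y = edge_arc y x;
  edge_arcP : forall x y, adj x y ->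
    is_arc (vertex_pt x) (vertex_pt y) (edge_arc x y);
  edge_arc_vertex : forall x y z, adj x y ->
    edge_arc x y (vertex_pt z) -> z \in [:: x; y];
  edge_arc_cross : forall x y x' y', adj x y -> adj x' y' ->
    (x', y') \notin [:: (x, y); (y, x)] ->
    edge_arc x y `&` edge_arc x' y' `<=` range vertex_pt }.

Definition drawing_support (G : sgraph) (D : plane_drawing G) : set plane :=
  range (vertex_pt D) `|` [set q | exists x y, adj x y /\ edge_arc D x y q].

Definition is_face (G : sgraph) (D : plane_drawing G) (F : set plane) : Prop :=
  exists2 q, (~` drawing_support D) q &
             F = connected_component (~` drawing_support D) q.

Definition boundary (A : set plane) : set plane := closure A `\` A°.

Definition outerplanar (G : sgraph) : Prop :=
  exists (D : plane_drawing G) (F : set plane),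
    [/\ is_face D F, ~ bounded_set F & forall x, boundary F (vertex_pt D x)].

End Outerplanar.

(* Main.v *)
(* Outerplanarity is used through two exclusions. Follow the outer face from an
   interior point q to every vertex x: this adds an apex to the drawing, and
   the added connected sets stay at positive distance from the edges not
   incident to x. Discretize all pieces into chains with tiny steps. The parity
   of the crossings of the difference vector with a fixed ray is a mod 2 cocycle
   on products of disjoint chains, and summing over all independent pairs of
   edges of a K_5 or K_{3,3} gives 0 = 1 (the van Kampen obstruction). Hence an
   outerplanar graph contains no K_{2,3} and, arcs being concatenated, no
   subdivided K_4. A longest path with a shortest first chord produces a
   subdivided K_4 when all degrees are at least 3, so some degree is at most 2.
   As alpha_ir = 1 means that vertices of different degrees are adjacent, a
   vertex of minimum degree d <= 2 has at most d vertices of another degree.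
   Conversely, all graphs listed have a vertex order without crossing
   chords, hence a straight drawing on a parabola. *)
Require Import Defs.
From mathcomp Require Import all_boot all_order all_algebra.
From mathcomp Require Import zify ring lra.
From mathcomp Require Import all_classical all_reals all_analysis.

Set Implicit Arguments.
Unset Strict Implicit.
Unset Printing Implicit Defensive.

Import Order.TTheory GRing.Theory Num.Theory.
Import numFieldNormedType.Exports.

Local Open Scope classical_set_scope.
Local Open Scope ring_scope.

(** * Crossing parity of chains *)

Section RayCrossing.
Variable R : realType.
Notation plane := (R * R)%type.
Implicit Types (a b c d p q : plane) (s t : seq plane) (r e : R).

Lemma plane_ballE p q e :
  ball p e q <-> `|p.1 - q.1| < e /\ `|p.2 - q.2| < e.
Proof. by []. Qed.

(* The tie-breaking makes [upper (- u) = ~~ upper u] hold for all [u != 0]. *)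
Definition upper p : bool := (0 < p.2) || ((p.2 == 0) && (0 < p.1)).

Lemma upperN p q : p != q -> upper (p - q) = ~~ upper (q - p).
Proof.
move=> pq; rewrite /upper /=.
have [h1|h1|h1] := ltrgtP p.2 q.2.
- have -> : 0 < q.2 - p.2 by lra.
  have -> : 0 < p.2 - q.2 = false by lra.
  have -> : (p.2 - q.2 == 0) = false by lra.
  by [].
- have -> : 0 < q.2 - p.2 = false by lra.
  have -> : 0 < p.2 - q.2 by lra.
  have -> : (q.2 - p.2 == 0) = false by lra.
  by [].
- rewrite h1 subrr ltxx eqxx /=.
  have [h2|h2|h2] := ltrgtP p.1 q.1; [by lra|by lra|].
  by case/eqP: pq; case: p q h1 h2 => p1 p2 [q1 q2] /= -> ->.
Qed.

(** Detects a step across the positive first axis. The sign of [p.1] alone suffices for short steps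
    far from the origin, since there a change of [upper] forces [p.1] and [q.1] to have the same
    sign. *)
Definition crosses p q : bool := (upper p (+) upper q) && (0 < p.1).

Lemma apartP r p q : ~ ball p (3 * r) q ->
  3 * r <= `|p.1 - q.1| \/ 3 * r <= `|p.2 - q.2|.
Proof.
move=> h; have [h1|h1] := ltP `|p.1 - q.1| (3 * r); last by left.
by have [h2|h2] := ltP `|p.2 - q.2| (3 * r); [case: h|right].
Qed.

(** Some coordinate of [a - c] has absolute value at least [3 * r], and the other differences are
    less than [2 * r] away, so all four keep its sign. If it is the first coordinate, [crosses] is
    zero or a coboundary of [upper]; if it is the second, [upper] is constant. This is the cocycle
    property modulo 2. *)
Lemma crosses_square r a b c d : ball a r b -> ball c r d ->
    ~ ball a (3 * r) c ->
  crosses (a - c) (b - c) (+) crosses (a - d) (b - d) (+)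
  crosses (a - c) (a - d) (+) crosses (b - c) (b - d) = false.
Proof.
move=> /plane_ballE[ab1 ab2] /plane_ballE[cd1 cd2] /apartP h.
have r0 : 0 < r by apply: le_lt_trans ab1.
move: ab1 ab2 cd1 cd2; rewrite !ltr_norml.
move=> /andP[? ?] /andP[? ?] /andP[? ?] /andP[? ?].
rewrite /crosses /=.
case: h; rewrite ler_normr => /orP[h|h].
- have -> : 0 < a.1 - c.1 by lra.
  have -> : 0 < a.1 - d.1 by lra.
  have -> : 0 < b.1 - c.1 by lra.
  by do 4!case: (upper _).
- have -> : 0 < a.1 - c.1 = false by lra.
  have -> : 0 < a.1 - d.1 = false by lra.
  have -> : 0 < b.1 - c.1 = false by lra.
  by rewrite !andbF.
- have up p q : 0 < p.2 - q.2 -> upper (p - q) = true by rewrite /upper /= => ->.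
  by rewrite !up //; lra.
- have dn p q : p.2 - q.2 < 0 -> upper (p - q) = false.
    by rewrite /upper /= => ?; rewrite lt_gtF ?lt_eqF.
  by rewrite !dn //; lra.
Qed.

(** Negating the differences exchanges the two horizontal half-axes, and together these are crossed
    once for each change of [upper]. *)
Lemma crossesN r a b c : ball a r b -> ~ ball a (3 * r) c ->
  crosses (c - a) (c - b) =
  crosses (a - c) (b - c) (+) upper (c - a) (+) upper (c - b).
Proof.
move=> /plane_ballE[ab1 ab2] ac.
have r0 : 0 < r by apply: le_lt_trans ab1.
have nac : a != c by apply/eqP => e; apply: ac; rewrite e; apply: ballxx; lra.
have nbc : b != c.
  apply/eqP => e; apply: ac; rewrite -e; apply/plane_ballE; split; lra.
move: ab1 ab2; rewrite !ltr_norml => /andP[? ?] /andP[? ?].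
rewrite /crosses (upperN nac) (upperN nbc) /=.
case: (apartP ac); rewrite ler_normr => /orP[h|h].
- have -> : 0 < a.1 - c.1 by lra.
  have -> : 0 < c.1 - a.1 = false by lra.
  by do 2!case: (upper _).
- have -> : 0 < a.1 - c.1 = false by lra.
  have -> : 0 < c.1 - a.1 by lra.
  by do 2!case: (upper _).
- have dn p q : p.2 - q.2 < 0 -> upper (p - q) = false.
    by rewrite /upper /= => ?; rewrite lt_gtF ?lt_eqF.
  by rewrite !dn //; lra.
- have up p q : 0 < p.2 - q.2 -> upper (p - q) = true by rewrite /upper /= => ->.
  by rewrite !up //; lra.
Qed.

Fixpoint parity (f : rel plane) p s : bool :=
  if s is q :: s' then f p q (+) parity f q s' else false.

(* Parity of the number of crossings of the chain [p :: s] with the horizontal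
   ray from [c] to the right. *)
Definition ray_parity c p s := parity (fun a b => crosses (a - c) (b - c)) p s.

Definition chain r p s := path (fun a b => `[< ball a r b >]) p s.

Definition apart r (A B : set plane) :=
  forall p q, A p -> B q -> ~ ball p r q.

Lemma apart_sym r A B : apart r A B -> apart r B A.
Proof. by move=> h p q Ap Bq /ball_sym; apply: h. Qed.

Lemma apart_sub r (A B A' B' : set plane) :
  A `<=` A' -> B `<=` B' -> apart r A' B' -> apart r A B.
Proof. by move=> hA hB h p q /hA Ap /hB; apply: h. Qed.

Lemma apart_le r e A B : r <= e -> apart e A B -> apart r A B.
Proof. by move=> re h p q Ap Bq /(le_ball re); apply: h. Qed.

Lemma set_behead p s : [set` s] `<=` [set` p :: s].
Proof. by move=> x; rewrite /= in_cons => ->; rewrite orbT. Qed.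

(** [crosses_square] is summed along the chain; the sides shared by consecutive squares cancel. *)
Lemma parity_row r p s c d : chain r p s -> ball c r d ->
    apart (3 * r) [set` p :: s] [set c] ->
  ray_parity c p s (+) ray_parity d p s =
  crosses (p - c) (p - d) (+) crosses (last p s - c) (last p s - d).
Proof.
move=> + cd; elim: s p => [|q s IH] p /=; first by rewrite addbb.
move=> /andP[/asboolP pq qs] h.
have hq : apart (3 * r) [set` q :: s] [set c].
  by apply: apart_sub h => //; apply: set_behead.
have := crosses_square pq cd (h p c (mem_head _ _) erefl).
have := IH _ qs hq; rewrite /ray_parity /=.
do 2!case: (parity _ _ _); by do 5!case: (crosses _ _).
Qed.

(** The [upper] terms of [crossesN] telescope along the chain. *)
Lemma parity_col r p c t : chain r c t ->
    apart (3 * r) [set p] [set` c :: t] ->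
  parity (fun a b => crosses (p - a) (p - b)) c t =
  ray_parity p c t (+) upper (p - c) (+) upper (p - last c t).
Proof.
elim: t c => [|d t IH] c /=; first by rewrite addbb.
move=> /andP[/asboolP cd dt] h.
have hd : apart (3 * r) [set p] [set` d :: t].
  by apply: apart_sub h => //; apply: set_behead.
have cp : ~ ball c (3 * r) p.
  by move/ball_sym; apply: h => //=; rewrite mem_head.
rewrite (crossesN cd cp) (IH _ dt hd) /ray_parity /=.
do 3!case: (upper _); by case: (crosses _ _); case: (parity _ _ _).
Qed.

Lemma parity_grid r p s c t : chain r p s -> chain r c t ->
    apart (3 * r) [set` p :: s] [set` c :: t] ->
  ray_parity c p s (+) ray_parity (last c t) p s =
  parity (fun a b => crosses (p - a) (p - b)) c t (+)
  parity (fun a b => crosses (last p s - a) (last p s - b)) c t.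
Proof.
move=> ps; elim: t c => [|d t IH] c /=; first by rewrite addbb.
move=> /andP[/asboolP cd dt] h.
have hd : apart (3 * r) [set` p :: s] [set` d :: t].
  by apply: apart_sub h => //; apply: set_behead.
have hc : apart (3 * r) [set` p :: s] [set c].
  by apply: apart_sub h => // x ->; rewrite /= mem_head.
have := parity_row ps cd hc; have := IH _ dt hd; rewrite /=.
do 3!case: (ray_parity _ _ _); do 2!case: (parity _ _ _);
by do 2!case: (crosses _ _).
Qed.

(** By [parity_grid], the crossings around the boundary of the product of the two chains are even in
    number. Two of its sides are read with the roles of the chains exchanged, by [parity_col], which
    leaves the [upper] terms at the four pairs of end points. *)
Lemma parity_chains r p s c t : chain r p s -> chain r c t ->
    apart (3 * r) [set` p :: s] [set` c :: t] ->
  let p' := last p s in let c' := last c t in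
  ray_parity c p s (+) ray_parity c' p s (+)
  ray_parity p c t (+) ray_parity p' c t =
  upper (p - c) (+) upper (p - c') (+) upper (p' - c) (+) upper (p' - c').
Proof.
move=> ps ct h p' c'.
have hp : apart (3 * r) [set p] [set` c :: t].
  by apply: apart_sub h => // x ->; rewrite /= mem_head.
have hp' : apart (3 * r) [set p'] [set` c :: t].
  by apply: apart_sub h => // x ->; rewrite /= mem_last.
have := parity_grid ps ct h; rewrite (parity_col ct hp) (parity_col ct hp').
rewrite -/p' -/c'.
by do 4!case: (ray_parity _ _ _); do 4!case: (upper _).
Qed.

End RayCrossing.

(** [P] cuts out a nonempty subset of [A] that is both relatively open and relatively closed. *)
Lemma connected_ind (T : topologicalType) (A P : set T) a :
    connected A -> A a -> P a ->
    (forall z, A z -> \forall w \near z, A w -> (P z <-> P w)) ->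
  A `<=` P.
Proof.
move=> cA Aa Pa hP.
suff <- : A `&` P = A by apply: subIsetr.
apply: cA; first by exists a.
- exists [set w | A w -> P w]°; first exact: open_interior.
  apply/seteqP; split=> z [Az].
    by move=> Pz; split=> //; apply: filterS (hP _ Az) => w h /h <-.
  by move=> /interior_subset /(_ Az).
- exists (~` [set w | A w -> ~ P w]°); first exact: open_closedC (open_interior _).
  apply/seteqP; split=> z [Az].
    by move=> Pz; split=> // /interior_subset /(_ Az).
  move=> h; split=> //; apply: contrapT => nPz; apply: h.
  by apply: filterS (hP _ Az) => w h /h <-.
Qed.

(** * Nonplanarity of $K_5$ and $K_{3,3}$ by the van Kampen obstruction *)

Section Nonplanarity.
Variable R : realType.
Notation plane := (R * R)%type.

(** Being reachable by a chain inside [A] is locally constant on [A]: one more step reaches every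
    point of [A] within [r] of a reached one. *)
Lemma connected_chain (A : set plane) a b (r : R) : 0 < r ->
    connected A -> A a -> A b ->
  exists s, [/\ chain r a s, last a s = b & [set` a :: s] `<=` A].
Proof.
move=> r0 cA Aa Ab.
pose P := [set z | exists s, [/\ chain r a s, last a s = z & [set` a :: s] `<=` A]].
apply: (@connected_ind _ A P a) => //.
  by exists [::]; split=> // x; rewrite /= inE => /eqP ->.
have ext z w : A w -> ball z r w -> P z -> P w.
  move=> Aw zw [s [cs ls sA]]; exists (rcons s w); split.
  - by rewrite /chain rcons_path; apply/andP; split=> //; apply/asboolP; rewrite ls.
  - by rewrite last_rcons.
  - move=> x; rewrite /= -rcons_cons mem_rcons in_cons => /orP[/eqP -> //|].
    exact: sA.
move=> z Az; apply: filterS (nbhsx_ballx z r r0) => w zw Aw; split.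
  exact: ext.
by apply: ext => //; apply: ball_sym.
Qed.

(** Every connected set is replaced by a chain with steps below [e / 3], because [parity_chains]
    asks for a distance of three steps. [p a b c] is the crossing parity of the chain from [a] to
    [b] with the ray at [c], and [u a c] is the half-plane of [pt a - pt c]. What remains is linear
    algebra over the field with two elements. *)
Lemma crossing_equations (V : eqType) (E : rel V) (pt : V -> plane)
    (A : V -> V -> set plane) (e : R) : 0 < e ->
    (forall a b, E a b -> [/\ connected (A a b), A a b (pt a) & A a b (pt b)]) ->
    (forall a b c d, E a b -> E c d -> uniq [:: a; b; c; d] ->
      apart e (A a b) (A c d)) ->
  exists (p : V -> V -> V -> bool) (u : V -> V -> bool),
    forall a b c d, E a b -> E c d -> uniq [:: a; b; c; d] ->
      {in [:: a; b] & [:: c; d], forall x y, u x y = ~~ u y x} /\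
      p a b c (+) p a b d (+) p c d a (+) p c d b =
      u a c (+) u a d (+) u b c (+) u b d.
Proof.
move=> e0 hA hap.
have r0 : 0 < e / 3 by rewrite divr_gt0.
have /choice[ch hch] : forall ab : V * V, exists s, E ab.1 ab.2 ->
    [/\ chain (e / 3) (pt ab.1) s, last (pt ab.1) s = pt ab.2 &
        [set` pt ab.1 :: s] `<=` A ab.1 ab.2].
  move=> [a b] /=; have [/hA[h1 h2 h3]|_] := boolP (E a b); last by exists [::].
  by have [s hs] := connected_chain r0 h1 h2 h3; exists s.
exists (fun a b c => ray_parity (pt c) (pt a) (ch (a, b))).
exists (fun a c => upper (pt a - pt c)).
move=> a b c d ab cd uq.
have [/= c1 l1 s1] := hch (a, b) ab.
have [/= c2 l2 s2] := hch (c, d) cd.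
have hap' : apart (3 * (e / 3)) [set` pt a :: ch (a, b)] [set` pt c :: ch (c, d)].
  by rewrite mulrC divfK ?pnatr_eq0 //; apply: apart_sub (hap _ _ _ _ ab cd uq).
split; last by have := parity_chains c1 c2 hap'; rewrite /= l1 l2.
move=> x y hx hy; apply: upperN; apply/eqP => xy.
have [_ Aa Ab] := hA _ _ ab; have [_ Ac Ad] := hA _ _ cd.
apply: (hap _ _ _ _ ab cd uq (pt x) (pt y)).
- by move: hx; rewrite !inE => /orP[] /eqP->.
- by move: hy; rewrite !inE => /orP[] /eqP->.
- by rewrite xy; apply: ballxx.
Qed.

Lemma big_addb_even (T : eqType) (v : T -> bool) (s : seq T) :
    all (fun x => ~~ odd (count_mem x s)) s ->
  \big[addb/false]_(x <- s) v x = false.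
Proof.
move=> /allP ev; rewrite -big_undup_iterop_count big_seq_cond big1 // => x.
rewrite andbT mem_undup => /ev.
have -> n : iterop n addb (v x) false = odd n && v x.
  by elim: n => // -[|n] //= ->; case: (odd n); case: (v x).
by move/negbTE->.
Qed.

(* The variables of an equation of [crossing_equations]: [(a.+1, b, c)] stands
   for [p a b c] and [(0, a, c)] with [a <= c] for [u a c]. *)
Definition equation_vars (q : nat * nat * nat * nat) : seq (nat * nat * nat) :=
  let: (a, b, c, d) := q in
  [:: (a.+1, b, c); (a.+1, b, d); (c.+1, d, a); (c.+1, d, b);
      (0, minn a c, maxn a c); (0, minn a d, maxn a d);
      (0, minn b c, maxn b c); (0, minn b d, maxn b d)]%N.

(** Sorting the arguments of [u] costs one negation for each pair in the wrong order. *)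
Definition equation_swaps (q : nat * nat * nat * nat) : bool :=
  let: (a, b, c, d) := q in (c < a)%N (+) (d < a)%N (+) (c < b)%N (+) (d < b)%N.

(** For the two edge relations used below, each edge occurs in one orientation, and [a < c] keeps
    one order of each pair of edges. *)
Definition independent_pairs (E : rel nat) n : seq (nat * nat * nat * nat) :=
  let V := iota 0 n in
  [seq q <- [seq (abc, d) |
            abc <- [seq (ab, c) | ab <- [seq (a, b) | a <- V, b <- V], c <- V],
            d <- V] |
     let: (a, b, c, d) := q in
     [&& E a b, E c d, uniq [:: a; b; c; d] & (a < c)%N]].

(* Summed over all independent pairs, every variable cancels modulo 2 while the
   number of swaps is odd. *)
Definition odd_crossing (E : rel nat) n : bool :=
  let Q := independent_pairs E n in
  let vars := flatten (map equation_vars Q) in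
  all (fun x => ~~ odd (count_mem x vars)) vars &&
  foldr addb false (map equation_swaps Q).

Lemma odd_crossing_nonplanar (E : rel nat) n (pt : nat -> plane)
    (A : nat -> nat -> set plane) (e : R) :
    odd_crossing E n -> 0 < e ->
    (forall a b, E a b -> [/\ connected (A a b), A a b (pt a) & A a b (pt b)]) ->
    (forall a b c d, E a b -> E c d -> uniq [:: a; b; c; d] ->
      apart e (A a b) (A c d)) ->
  False.
Proof.
move=> /andP[ev od] e0 h1 h2.
have [p [u h]] := crossing_equations e0 h1 h2.
pose v x := let: (a, b, c) := x : nat * nat * nat in
  if a is a'.+1 then p a' b c else u b c.
have uE x y : x != y -> u x y = ~~ u y x ->
    u x y = u (minn x y) (maxn x y) (+) (y < x)%N.
  by move=> xy h'; have [lt|lt|eq] := ltngtP x y; rewrite ?addbF ?h' ?addbT //;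
    rewrite eq eqxx in xy.
have := big_addb_even v ev; move: od; set Q := independent_pairs E n.
have: all (fun q => let: (a, b, c, d) := q in
    [&& E a b, E c d & uniq [:: a; b; c; d]]) Q.
  apply/allP => -[[[a b] c] d]; rewrite mem_filter => /andP[/and4P[-> -> -> _] _].
  by [].
(* Each equation says that its eight variables add up to its [equation_swaps]. The total is
   therefore odd, although every variable occurs an even number of times. *)
move=> hQ; suff -> : \big[addb/false]_(x <- flatten (map equation_vars Q)) v x =
    foldr addb false (map equation_swaps Q) by move=> ->.
elim: Q hQ => [|[[[a b] c] d] Q IH]; first by rewrite big_nil.
rewrite [all _ _]/= => /andP[/and3P[ab cd uq] /IH {}IH].
rewrite [map _ _]/= [flatten _]/= [map _ (_ :: Q)]/= [foldr _ _ _]/=.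
rewrite -IH !big_cons; move: (\big[_/_]_(_ <- _) _) => z.
have [sw] := h _ _ _ _ ab cd uq.
move: uq; rewrite /= !inE !negb_or -!andbA => /and4P[_ ac ad /and3P[bc bd _]].
have {}uE x y : x \in [:: a; b] -> y \in [:: c; d] -> x != y ->
    u x y = u (minn x y) (maxn x y) (+) (y < x)%N.
  by move=> hx hy xy; apply: uE (sw _ _ hx hy).
rewrite (uE a c) ?(uE a d) ?(uE b c) ?(uE b d) ?inE ?eqxx ?orbT // !addbA => ->.
move: (u (minn a c) _) (u (minn a d) _) (u (minn b c) _) (u (minn b d) _)
  => v1 v2 v3 v4.
move: (c < a)%N (d < a)%N (c < b)%N (d < b)%N => c1 c2 c3 c4.
by case: v1; case: v2; case: v3; case: v4; case: c1; case: c2; case: c3;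
  case: c4; case: z.
Qed.

Lemma K5_nonplanar (pt : nat -> plane) (A : nat -> nat -> set plane) (e : R) :
    0 < e ->
    (forall a b, (a < b < 5)%N ->
      [/\ connected (A a b), A a b (pt a) & A a b (pt b)]) ->
    (forall a b c d, (a < b < 5)%N -> (c < d < 5)%N -> uniq [:: a; b; c; d] ->
      apart e (A a b) (A c d)) ->
  False.
Proof.
(* A finite check over the 15 independent pairs of edges of $K_5$. *)
have odd5 : odd_crossing (fun a b => a < b < 5)%N 5 by vm_compute.
exact: (odd_crossing_nonplanar odd5).
Qed.

Lemma K33_nonplanar (pt : nat -> plane) (A : nat -> nat -> set plane) (e : R) :
    0 < e ->
    (forall a b, [&& a < 3, 3 <= b & b < 6]%N ->
      [/\ connected (A a b), A a b (pt a) & A a b (pt b)]) ->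
    (forall a b c d, [&& a < 3, 3 <= b & b < 6]%N ->
      [&& c < 3, 3 <= d & d < 6]%N ->
      uniq [:: a; b; c; d] -> apart e (A a b) (A c d)) ->
  False.
Proof.
(* A finite check over the 18 independent pairs of edges of $K_{3,3}$. *)
have odd33 : odd_crossing (fun a b => [&& a < 3, 3 <= b & b < 6]%N) 6.
  by vm_compute.
exact: (odd_crossing_nonplanar odd33).
Qed.

End Nonplanarity.

(** * Connected pieces of a drawing *)

Section ConnectedPieces.
Variable R : realType.
Notation plane := (R * R)%type.

Lemma pair_continuous (f g : R -> R) : continuous f -> continuous g ->
  continuous (fun t => (f t, g t) : plane).
Proof.
move=> cf cg t A hA.
exact: (@cvg_pair _ _ _ (nbhs t) (nbhs (f t)) (nbhs (g t)) _ _ _ _ _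
  (cf t) (cg t) _ hA).
Qed.

Definition segment (a b : plane) (t : R) : plane :=
  (a.1 + t * (b.1 - a.1), a.2 + t * (b.2 - a.2)).

Lemma segment_continuous a b : continuous (segment a b).
Proof.
have lin (c d : R) : continuous (fun t : R => c + t * d : R).
  move=> t; apply: (@cvgD R R R (nbhs t) _ (fun=> c) (fun t => t * d)).
    exact: cvg_cst.
  by apply: cvgM; [exact: cvg_id|exact: cvg_cst].
by apply: pair_continuous; apply: lin.
Qed.

Lemma segment_image_connected a b : connected (segment a b @` `[0, 1]).
Proof.
apply: connected_continuous_connected; first exact: segment_connected.
exact/continuous_subspaceT/segment_continuous.
Qed.

(** The ball is star-shaped about its centre. *)
Lemma ball_connected (a : plane) r : 0 < r -> connected (ball a r).
Proof.
move=> r0; have -> : ball a r = \bigcup_(b in ball a r) segment a b @` `[0, 1].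
  apply/seteqP; split=> [b ab|_ [b /plane_ballE[ab1 ab2] [t /= t01 <-]]].
    exists b => //; exists 1; rewrite /= ?in_itv /= ?lexx ?ler01 //.
    by rewrite /segment !mul1r !subrKC; case: b {ab}.
  move: t01 ab1 ab2; rewrite in_itv /= => /andP[t0 t1] ab1 ab2.
  have le (x y : R) : `|x - y| < r -> `|x - (x + t * (y - x))| < r.
    rewrite opprD addrA subrr add0r normrN normrM (ger0_norm t0) distrC.
    by apply: le_lt_trans; rewrite ler_piMl.
  by apply/plane_ballE; split; apply: le.
apply: bigcup_connected; last by move=> b _; apply: segment_image_connected.
exists a => b _; exists 0; rewrite /= ?in_itv /= ?lexx ?ler01 //.
by rewrite /segment !mul0r !addr0; case: a.
Qed.

Lemma arc_pieceP (a b : plane) A : is_arc a b A ->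
  [/\ connected A, compact A, A a & A b].
Proof.
move=> [g [cg _ g0 g1 <-]]; split.
- by apply: connected_continuous_connected => //; exact: segment_connected.
- by apply: continuous_compact => //; exact: segment_compact.
- by exists 0; rewrite //= in_itv /= lexx ler01.
- by exists 1; rewrite //= in_itv /= lexx ler01.
Qed.

(** Every point of [A] has a ball that misses [B]; compactness, in its near-covering form, makes the
    radius uniform. Half of the local radius is spent on moving the point. *)
Lemma compact_apart (A B : set plane) : compact A -> closed B ->
  A `&` B = set0 -> exists2 e : R, 0 < e & apart e A B.
Proof.
move=> /compact_near_coveringP cA cB AB.
have : \forall e \near (0:R)^'+, A `<=` [set p | forall q, B q -> ~ ball p e q].
  apply: (cA R (0^'+)) => p Ap.
  have /nbhs_ballP[r /= r0 hr] : nbhs p (~` B).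
    apply: open_nbhs_nbhs; split; first exact: closed_openC.
    by move=> Bp; have : (A `&` B) p by []; rewrite AB.
  exists (ball p (r / 2), [set e | e <= r / 2]).
    by split; [apply: nbhsx_ballx; lra|apply: nbhs_right_ltW; lra].
  move=> [s e] /= [ps er] q Bq sq; apply: (hr q) => //.
  have -> : r = r / 2 + r / 2 by lra.
  exact: ball_triangle ps (le_ball er sq).
move=> h; near (0:R)^'+ => e; exists e => // p q Ap Bq.
have : A `<=` [set p | forall q, B q -> ~ ball p e q] by near: e.
by move=> /(_ _ Ap) /(_ _ Bq).
Unshelve. all: by end_near.
Qed.

Lemma uniform_pos (I : finType) (P : I -> R -> Prop) :
    (forall i, exists2 e : R, 0 < e & P i e) ->
    (forall i e e', e' <= e -> P i e -> P i e') ->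
  exists2 e : R, 0 < e & forall i, P i e.
Proof.
move=> hP mono.
have /choice[f hf] : forall i, exists e : R, 0 < e /\ P i e.
  by move=> i; have [e e0 he] := hP i; exists e.
exists (\big[Num.min/1]_i f i).
  by apply: lt_bigmin => // i _; have [] := hf i.
by move=> i; have [_] := hf i; apply: mono; apply: bigmin_le_cond.
Qed.

(** [F] itself may come arbitrarily close to the complement of [U], so a smaller connected set with
    a positive margin is wanted. The points reached by such sets form a relatively open and closed
    part of [F], since a small ball can be attached. *)
Lemma connected_in_open (U F : set plane) q p : open U -> connected F ->
    F `<=` U -> F q -> F p ->
  exists C, exists2 e : R, 0 < e &
    [/\ connected C, C q, C p & apart e C (~` U)].
Proof.
move=> oU cF FU Fq; pose P z := exists C, exists2 e : R, 0 < e &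
    [/\ connected C, C q, C z & apart e C (~` U)].
suff : F `<=` P by apply.
have ball_apart z r : 0 < r -> ball z r `<=` U -> apart (r / 2) (ball z (r / 2)) (~` U).
  move=> r0 zU s t zs Ut st; apply: Ut; apply: zU.
  have -> : r = r / 2 + r / 2 by lra.
  exact: ball_triangle zs st.
apply: (connected_ind cF Fq).
  have /nbhs_ballP[r /= r0 hr] : nbhs q U.
    by apply: open_nbhs_nbhs; split=> //; apply: FU.
  have r20 : 0 < r / 2 by lra.
  exists (ball q (r / 2)), (r / 2) => //.
  by split; [exact: ball_connected|exact: ballxx|exact: ballxx|exact: ball_apart].
move=> z Fz; have /nbhs_ballP[r /= r0 hr] : nbhs z U.
  by apply: open_nbhs_nbhs; split=> //; apply: FU.
have r20 : 0 < r / 2 by lra.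
have extend x y : ball z (r / 2) x -> ball z (r / 2) y -> P x -> P y.
  move=> zx zy [C [e e0 [cC Cq Cx aC]]].
  exists (C `|` ball z (r / 2)), (Num.min e (r / 2)).
    by rewrite lt_min e0 r20.
  split; [|by left|by right|].
    by apply: connectedU => //; [exists x|exact: ball_connected].
  move=> s t [Cs|zs] Ut.
    by apply: (apart_le _ aC); rewrite // ge_min lexx.
  by apply: (apart_le _ (ball_apart z r r0 hr)); rewrite // ge_min lexx orbT.
apply: filterS (nbhsx_ballx z _ r20) => w zw Fw; split; apply: extend => //;
  exact: ballxx.
Qed.

End ConnectedPieces.

Section RobustDrawing.
Variables (R : realType) (G : sgraph).
Notation plane := (R * R)%type.

(** The diagonal makes a single vertex a degenerate edge, so that vertices and edges are separated
    by the same statements. *)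
Definition linked (x y : G) := (x == y) || adj x y.

Section Pieces.
Variable D : plane_drawing R G.

(** The default for non-adjacent pairs keeps every piece compact and makes the drawing the union of
    all pieces. *)
Definition piece x y : set plane :=
  if adj x y then edge_arc D x y else [set vertex_pt D x].

Lemma piece_connected x y : linked x y ->
  [/\ connected (piece x y), piece x y (vertex_pt D x) &
      piece x y (vertex_pt D y)].
Proof.
rewrite /linked /piece; have [xy _|_] := boolP (adj x y).
  by have [] := arc_pieceP (edge_arcP D xy).
by rewrite orbF => /eqP <-; split=> //; exact: connected1.
Qed.

Lemma piece_compact x y : compact (piece x y).
Proof.
rewrite /piece; have [xy|_] := boolP (adj x y).
  by have [] := arc_pieceP (edge_arcP D xy).
exact: compact_set1.
Qed.

(** A common point of two arcs is a vertex point by [edge_arc_cross], and then a common end by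
    [edge_arc_vertex]. *)
Lemma piece_disjoint x y u v : linked x y -> linked u v ->
    x \notin [:: u; v] -> y \notin [:: u; v] ->
  piece x y `&` piece u v = set0.
Proof.
move=> xy uv nx ny; apply/seteqP; split=> // p [].
have onarc a b z : adj a b -> edge_arc D a b (vertex_pt D z) -> z \in [:: a; b].
  exact: edge_arc_vertex.
move: xy uv; rewrite /linked /piece.
have [xy _|_] := boolP (adj x y); last rewrite orbF => /eqP exy.
  have [uv _|_] := boolP (adj u v); last rewrite orbF => /eqP euv.
    move=> xyp uvp.
    have nuv : (u, v) \notin [:: (x, y); (y, x)].
      move: nx ny; rewrite !inE !negb_or !xpair_eqE => /andP[xu xv] /andP[yu yv].
      by rewrite ![u == _]eq_sym (negbTE xu) (negbTE yu).
    have [z _ zp] := @edge_arc_cross _ _ D _ _ _ _ xy uv nuv p (conj xyp uvp).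
    rewrite -{}zp in xyp uvp; have := onarc _ _ _ uv uvp.
    have := onarc _ _ _ xy xyp; rewrite !inE => /orP[]/eqP -> h.
      by move: nx; rewrite !inE h.
    by move: ny; rewrite !inE h.
  move=> xyp pu; rewrite pu in xyp; have := onarc _ _ _ xy xyp.
  move: nx ny; rewrite !inE !negb_or => /andP[xu _] /andP[yu _].
  by rewrite ![u == _]eq_sym (negbTE xu) (negbTE yu).
have [uv _|_] := boolP (adj u v); last rewrite orbF => /eqP euv.
  move=> -> uvp; have := onarc _ _ _ uv uvp.
  by rewrite (negbTE nx).
by move=> -> /vertex_pt_inj e; rewrite e mem_head in nx.
Qed.

Lemma drawing_supportE :
  drawing_support D = \bigcup_(xy : G * G) piece xy.1 xy.2.
Proof.
apply/seteqP; split=> p.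
  move=> [[x _ <-]|[x [y [xy pxy]]]].
    by exists (x, x); rewrite // /piece /= adj_irrefl.
  by exists (x, y); rewrite // /piece /= xy.
move=> [[x y] _]; rewrite /piece /=; have [xy|_] := boolP (adj x y).
  by move=> pxy; right; exists x, y.
by move=> ->; left; exists x.
Qed.

Lemma drawing_support_closed : closed (drawing_support D).
Proof.
rewrite drawing_supportE; apply: closed_bigcup => [|[x y] _].
  exact: finite_finset.
by apply: compact_closed; [exact: norm_hausdorff|exact: piece_compact].
Qed.

Lemma pieces_apart : exists2 e : R, 0 < e & forall x y u v,
  linked x y -> linked u v -> x \notin [:: u; v] -> y \notin [:: u; v] ->
  apart e (piece x y) (piece u v).
Proof.
have [||e e0 he] := @uniform_pos R (G * G * G * G)%type
  (fun q e => let: (x, y, u, v) := q in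
     linked x y -> linked u v -> x \notin [:: u; v] -> y \notin [:: u; v] ->
     apart e (piece x y) (piece u v)).
- move=> [[[x y] u] v].
  have [/and4P[xy uv nx ny]|no] := boolP
    [&& linked x y, linked u v, x \notin [:: u; v] & y \notin [:: u; v]].
    have cl : closed (piece u v).
      by apply: compact_closed; [exact: norm_hausdorff|exact: piece_compact].
    have [e e0 he] := compact_apart (@piece_compact x y) cl
      (piece_disjoint xy uv nx ny).
    by exists e.
  by exists 1 => // xy uv nx ny; rewrite xy uv nx ny in no.
- move=> [[[x y] u] v] e e' ee h xy uv nx ny.
  exact: apart_le ee (h xy uv nx ny).
- by exists e => // x y u v; apply: (he (x, y, u, v)).
Qed.

End Pieces.

(* Every vertex [x] is joined to a common point [q] of the face by a connected
   set [Q x] that stays away from all pieces of the drawing not incident to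
   [x]: this set follows the face up to a small ball around [x]. *)
Lemma outerplanar_robust : outerplanar R G ->
  exists (e : R) (q : plane) (pt : G -> plane) (P : G -> G -> set plane)
    (Q : G -> set plane), 0 < e /\
  [/\ forall x y, linked x y -> [/\ connected (P x y), P x y (pt x) & P x y (pt y)],
      forall x, [/\ connected (Q x), Q x q & Q x (pt x)],
      forall x y u v, linked x y -> linked u v ->
        x \notin [:: u; v] -> y \notin [:: u; v] -> apart e (P x y) (P u v) &
      forall x u v, linked u v -> x \notin [:: u; v] -> apart e (Q x) (P u v)].
Proof.
move=> [D [F [[q Sq FE] _ bF]]].
have [e1 e10 he1] := pieces_apart D.
set U := ~` drawing_support D in Sq FE *.
have oU : open U by apply: closed_openC; apply: drawing_support_closed.
have cF : connected F by rewrite FE; apply: component_connected.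
have FU : F `<=` U by rewrite FE; apply: connected_component_sub.
have Fq : F q by rewrite FE; apply: connected_component_refl.
(* Half of the distance between the pieces is the radius of the balls around the vertices; the other
   half remains as their margin. *)
have e20 : 0 < e1 / 2 by lra.
have /choice[p hp] x : exists p, F p /\ ball (vertex_pt D x) (e1 / 2) p.
  have [/(_ _ (nbhsx_ballx _ _ e20))[p [Fp xp]] _] := bF x.
  by exists p.
have /choice[C hC] x : exists C, exists2 e : R, 0 < e &
    [/\ connected C, C q, C (p x) & apart e C (~` U)].
  by apply: connected_in_open oU cF FU Fq _; have [] := hp x.
have [||e2 e2_gt0 he2] := @uniform_pos R G (fun x e => apart e (C x) (~` U)).
- by move=> x; have [e e0 []] := hC x; exists e.
- by move=> x e e' ee; apply: apart_le.
exists (Num.min (e1 / 2) e2), q, (vertex_pt D), (piece D).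
exists (fun x => C x `|` ball (vertex_pt D x) (e1 / 2)).
split; first by rewrite lt_min e20.
split.
- exact: piece_connected.
- move=> x; have [e e0 [cC Cq Cp _]] := hC x; split; [|by left|by right; exact: ballxx].
  apply: connectedU => //; last exact: ball_connected.
  by exists (p x); split=> //; have [] := hp x.
- move=> x y u v xy uv nx ny; apply: apart_le (he1 _ _ _ _ xy uv nx ny).
  by rewrite ge_min; apply/orP; left; lra.
- move=> x u v uv nx s t [Cs|xs] tuv st.
    have Ut : (~` U) t.
      by rewrite /U setCK drawing_supportE; exists (u, v).
    by apply: (he2 x s t Cs Ut); apply: le_ball st; rewrite ge_min lexx orbT.
  have xx : linked x x by rewrite /linked eqxx.
  apply: (he1 x x u v xx uv nx nx (vertex_pt D x) t _ tuv).
    by have [_ + _] := piece_connected D xx.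
  have -> : e1 = e1 / 2 + e1 / 2 by lra.
  by apply: ball_triangle xs (le_ball _ st); rewrite ge_min lexx.
Qed.

End RobustDrawing.

(** * Subgraphs excluded by outerplanarity *)

Section ForbiddenSubgraphs.
Variables (R : realType) (G : sgraph).
Notation plane := (R * R)%type.

(** The point [q] of the face, joined to the three vertices of [t], is a third vertex on the side of
    [s] and completes a $K_{3,3}$. *)
Lemma outerplanar_K23_free (s t : seq G) : outerplanar R G ->
    size s = 2%N -> size t = 3%N -> uniq (s ++ t) ->
  ~ {in s & t, forall x y, adj x y}.
Proof.
move=> /outerplanar_robust[e [q [pt [P [Q [e0 [hP hQ aP aQ]]]]]]] s2 t3 st adjst.
have [x0 _] : exists x : G, x \in s.
  by case: s s2 {st adjst} => // x s; exists x; exact: mem_head.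
(* Index 0 is reserved for the apex and its entry is a dummy; 1 and 2 are the vertices of [s], and
   3, 4, 5 those of [t]. *)
pose v a := nth x0 (x0 :: s ++ t) a.
have vE a b : (0 < a < 6)%N -> (0 < b < 6)%N -> (v a == v b) = (a == b).
  case: a b => [|a] [|b] //= a6 b6; rewrite /v /= nth_uniq // size_cat s2 t3; lia.
have vadj a b : (0 < a < 3)%N -> (2 < b < 6)%N -> linked (v a) (v b).
  case: a b => [|a] [|b] //= a3 b6; rewrite /linked /v /= !nth_cat s2.
  have -> : (a < 2)%N by [].
  have -> : (b < 2)%N = false by lia.
  by rewrite adjst ?orbT ?mem_nth ?s2 ?t3 //; lia.
pose A a b := if a == 0%N then Q (v b) else P (v a) (v b).
pose pt' a := if a == 0%N then q else pt (v a).
apply: (@K33_nonplanar R pt' A e e0).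
- move=> a b ab; rewrite /A /pt'; have -> : (b == 0)%N = false by lia.
  by case: eqP => a0; [apply: hQ|apply: hP; apply: vadj; lia].
(* Two independent edges cannot both use the apex, so up to exchanging them [c] is an ordinary
   vertex. *)
- have main a b c d : [&& a < 3, 3 <= b & b < 6]%N ->
      [&& c < 3, 3 <= d & d < 6]%N -> uniq [:: a; b; c; d] -> c != 0%N ->
      apart e (A a b) (A c d).
    move=> ab cd /=; rewrite !inE !negb_or -!andbA.
    move=> /and4P[_ ac ad /and4P[bc bd _ _]] c0.
    rewrite /A (negbTE c0); case: eqP => a0; [apply: aQ|apply: aP];
      by rewrite ?inE ?negb_or ?vE ?bc ?bd ?ac ?ad ?vadj //; lia.
  move=> a b c d ab cd uq; have [c0|c0] := eqVneq c 0%N; last exact: main.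
  have rot : uniq [:: c; d; a; b] by rewrite -(rot_uniq 2).
  apply: apart_sym; apply: main => //.
  by apply: contraTneq rot => ->; rewrite c0 /= !inE eqxx orbT.
Qed.

Definition linked_in (B : {set G}) : rel G :=
  connect [rel x y | [&& x \in B, y \in B & linked x y]].

(** The pieces along a path inside [B] are concatenated. Recording on which pieces the points of [X]
    lie carries the separation of pieces over to [X]. *)
Lemma linked_in_connected (pt : G -> plane) (P : G -> G -> set plane)
    (B : {set G}) x y :
    (forall x y, linked x y -> [/\ connected (P x y), P x y (pt x) & P x y (pt y)]) ->
    x \in B -> linked_in B x y ->
  exists X, [/\ connected X, X (pt x), X (pt y) &
    forall p, X p -> exists u v, [/\ u \in B, v \in B, linked u v & P u v p]].
Proof.
move=> hP xB /connectP[s + ->] {y}; elim: s x xB => [|z s IH] x xB /=.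
  move=> _; have xx : linked x x by rewrite /linked eqxx.
  have [c px _] := hP _ _ xx; exists (P x x); split=> // p Pp.
  by exists x, x; split.
move=> /andP[/and3P[_ zB xz] /(IH _ zB)[X [cX Xz Xl hX]]].
have [c px pz] := hP _ _ xz; exists (P x z `|` X); split.
- by apply: connectedU => //; exists (pt z).
- by left.
- by right.
- by move=> p [Pp|/hX //]; exists x, z; split.
Qed.

(** The branch vertices are numbered 1 to 4, and [B a b] holds the subdivided edge between [a] and
    [b]. With the apex as vertex 0 this gives a $K_5$; only subdivided edges without a common end
    have to be disjoint. *)
Lemma outerplanar_K4_subdivision_free (v : nat -> G) (B : nat -> nat -> {set G}) :
    outerplanar R G ->
    (forall a b, (0 < a < b)%N -> (b < 5)%N ->
      v a \in B a b /\ linked_in (B a b) (v a) (v b)) ->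
    (forall a b c, (0 < a < b)%N -> (b < 5)%N -> (0 < c < 5)%N ->
      c \notin [:: a; b] -> v c \notin B a b) ->
    (forall a b c d, (0 < a < b)%N -> (b < 5)%N -> (0 < c < d)%N -> (d < 5)%N ->
      uniq [:: a; b; c; d] -> {in B a b, forall x, x \notin B c d}) ->
  False.
Proof.
move=> /outerplanar_robust[e [q [pt [P [Q [e0 [hP hQ aP aQ]]]]]]] hB hv hd.
have /choice[X hX] : forall ab : nat * nat, exists X : set plane,
    (0 < ab.1 < ab.2)%N -> (ab.2 < 5)%N ->
    [/\ connected X, X (pt (v ab.1)), X (pt (v ab.2)) & forall p, X p ->
     exists x y, [/\ x \in B ab.1 ab.2, y \in B ab.1 ab.2, linked x y & P x y p]].
  move=> [a b] /=; have [/andP[ab b5]|no] := boolP ((0 < a < b)%N && (b < 5)%N).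
    have [vB lB] := hB _ _ ab b5.
    by have [X hX] := linked_in_connected hP vB lB; exists X.
  by exists set0 => ab b5; rewrite ab b5 in no.
pose A a b := if a == 0%N then Q (v b) else X (a, b).
pose pt' a := if a == 0%N then q else pt (v a).
apply: (@K5_nonplanar R pt' A e e0).
- move=> a b ab; rewrite /A /pt'; have -> : (b == 0)%N = false by lia.
  case: eqP => a0; first exact: hQ.
  by have [] := hX (a, b); rewrite /=; lia || split.
- have main a b c d : (a < b < 5)%N -> (c < d < 5)%N ->
      uniq [:: a; b; c; d] -> c != 0%N -> apart e (A a b) (A c d).
    move=> ab cd uq c0; have cd1 : (0 < c < d)%N by lia.
    have d5 : (d < 5)%N by lia.
    rewrite /A (negbTE c0); have [_ _ _ hcd] := hX (c, d) cd1 d5.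
    case: eqP => a0 s t.
      move=> Qs /hcd[/= x [y [xB yB xy Pt]]]; apply: (aQ (v b) x y) => //.
      have : v b \notin B c d.
        by apply: hv => //; move: uq; rewrite /= !inE; lia.
      by apply: contra; rewrite !inE => /orP[] /eqP->.
    have ab1 : (0 < a < b)%N by lia.
    have b5 : (b < 5)%N by lia.
    have dis := hd _ _ _ _ ab1 b5 cd1 d5 uq.
    have [_ _ _ hab] := hX (a, b) ab1 b5.
    move=> /hab[/= x [y [xB yB xy Ps]]] /hcd[/= x' [y' [xB' yB' xy' Pt]]].
    by apply: (aP x y x' y') => //; [move: (dis x xB)|move: (dis y yB)];
      apply: contra; rewrite !inE => /orP[] /eqP->.
  move=> a b c d ab cd uq; have [c0|c0] := eqVneq c 0%N; last exact: main.
  have rot : uniq [:: c; d; a; b] by rewrite -(rot_uniq 2).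
  apply: apart_sym; apply: main => //.
  by apply: contraTneq rot => ->; rewrite c0 /= !inE eqxx orbT.
Qed.

End ForbiddenSubgraphs.

(** * Subdivided K_4 from minimum degree 3 *)

Section MinimumDegree.
Variable G : sgraph.

Definition is_path (l : seq G) := uniq l && sorted adj l.

(* Rotating a path at its first chord: [l_(i-1) ... l_0 l_i l_(i+1) ...]. *)
Definition rotation i (l : seq G) := rev (take i l) ++ drop i l.

Lemma size_rotation i l : size (rotation i l) = size l.
Proof. by rewrite size_cat size_rev -size_cat cat_take_drop. Qed.

Lemma nth_rotation x0 i l m : (m < i <= size l)%N ->
  nth x0 (rotation i l) m = nth x0 l (i.-1 - m).
Proof.
move=> /andP[mi il]; rewrite nth_cat size_rev size_takel // mi.
rewrite nth_rev size_takel // nth_take; last lia.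
by congr nth; lia.
Qed.

Lemma mem_rotation i l : rotation i l =i l.
Proof. by move=> x; rewrite mem_cat mem_rev -mem_cat cat_take_drop. Qed.

(** The chord from position 0 to [i] replaces the edge between [i - 1] and [i]. *)
Lemma rotation_is_path x0 i l : is_path l -> (0 < i < size l)%N ->
  adj (nth x0 l 0) (nth x0 l i) -> is_path (rotation i l).
Proof.
move=> /andP[ul /(sortedP x0) sl] il h; apply/andP; split.
  rewrite (perm_uniq (s2 := l)) // -{2}(cat_take_drop i l) perm_cat2r.
  by rewrite perm_rev.
apply/(sortedP x0) => m; rewrite size_rotation => ml.
have [mi|mi|mi] := ltngtP m.+1 i.
- rewrite !nth_rotation; [|lia..]; rewrite adj_sym.
  have -> : (i.-1 - m = (i.-1 - m.+1).+1)%N by lia.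
  by apply: sl; lia.
- have n a : (i <= a)%N -> nth x0 (rotation i l) a = nth x0 l a.
    move=> ia; rewrite nth_cat size_rev size_takel; last lia.
    by rewrite ltnNge ia /= nth_drop; congr nth; lia.
  by rewrite !n; [apply: sl|lia..].
- rewrite nth_rotation; last lia.
  rewrite nth_cat size_rev size_takel; last lia.
  rewrite mi ltnn subnn nth_drop addn0.
  by have -> : (i.-1 - m = 0)%N by lia.
Qed.

Lemma degree3_nbr (x a b : G) : (2 < degree x)%N ->
  exists y, [/\ adj x y, y != a & y != b].
Proof.
move=> dx; case: (pickP [pred y | [&& adj x y, y != a & y != b]]) => [y|no].
  by move=> /and3P[]; exists y.
move: dx; rewrite ltnNge => /negP[]; apply: leq_trans (card_size [:: a; b]).
apply: subset_leq_card; apply/fintype.subsetP => y; rewrite !inE => xy.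
by have := no y; rewrite /= xy /=; case: eqP => //= _ /negbFE.
Qed.

(** Among all longest paths, one is taken whose first vertex has a chord to the smallest possible
    position [i]. Minimality sends a further chord of the first vertex beyond [i], and, applied to
    the rotated path, also a chord of the vertex at [i - 1]. *)
Lemma min_degree3_chords : (forall x : G, 2 < degree x)%N -> (0 < #|G|)%N ->
  exists (v : nat -> G) (k i j m : nat),
    [/\ {in gtn k &, injective v}, forall l, (l.+1 < k)%N -> adj (v l) (v l.+1),
        [/\ 1 < i < j, j < k, i < m & m < k]%N &
        [/\ adj (v 0) (v i), adj (v 0) (v j) & adj (v i.-1) (v m)]].
Proof.
move=> deg3 /card_gt0P[x0 _].
pose P n := `[< exists l, is_path l /\ size l = n >].
have exP : exists n, P n by exists 1%N; apply/asboolP; exists [:: x0].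
have leP n : P n -> (n <= #|G|)%N.
  by move=> /asboolP[l [/andP[ul _] <-]]; rewrite -(card_uniqP ul) max_card.
case: (ex_maxnP exP leP) => n /asboolP[l0 [pl0 sl0]] maxn.
have n0 : (0 < n)%N by apply: maxn; apply/asboolP; exists [:: x0].
(* A neighbour of the first vertex outside the path would extend it. *)
have nbr_in l x : is_path l -> size l = n -> adj (nth x0 l 0) x -> x \in l.
  move=> /andP[ul sl] nl lx; apply: contraT => xl.
  suff /maxn : P n.+1 by rewrite ltnn.
  apply/asboolP; exists (x :: l); rewrite /= nl; split=> //.
  apply/andP; split; first by rewrite /= xl.
  by case: l lx sl {ul nl xl} => //= y l; rewrite adj_sym => -> ->.
pose Q i := `[< exists l, [/\ is_path l, size l = n, (1 < i < n)%N &
  adj (nth x0 l 0) (nth x0 l i)] >].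
have nbr_Q l x : is_path l -> size l = n -> adj (nth x0 l 0) x ->
    x != nth x0 l 1 -> Q (index x l).
  move=> pl nl lx x1; have xl := nbr_in _ _ pl nl lx.
  apply/asboolP; exists l; split=> //; last by rewrite nth_index.
  rewrite -nl index_mem xl andbT; move: x1 lx; rewrite -{1 2}(nth_index x0 xl).
  by case: (index x l) => [|[|i]] //; rewrite ?adj_irrefl ?eqxx.
have exQ : exists i, Q i.
  have [y [xy y1 _]] := degree3_nbr (nth x0 l0 1) (nth x0 l0 1) (deg3 (nth x0 l0 0)).
  by exists (index y l0); apply: nbr_Q.
case: (ex_minnP exQ) => i /asboolP[l [pl nl /andP[i1 iN] li]] minQ.
have /andP[ul /(sortedP x0) sl] := pl.
have [y [ly y1 yi]] := degree3_nbr (nth x0 l 1) (nth x0 l i) (deg3 (nth x0 l 0)).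
have yl := nbr_in _ _ pl nl ly.
have ij : (i < index y l)%N.
  rewrite ltn_neqAle (minQ _ (nbr_Q _ _ pl nl ly y1)) andbT.
  by apply: contraNneq yi => ->; rewrite nth_index.
have pr : is_path (rotation i l) by apply: (rotation_is_path (x0 := x0)) => //; lia.
have nr : size (rotation i l) = n by rewrite size_rotation.
have r0 : nth x0 (rotation i l) 0 = nth x0 l i.-1.
  by rewrite nth_rotation ?subn0 //; lia.
have [z [lz z2 zi]] := degree3_nbr (nth x0 l i.-2) (nth x0 l i) (deg3 (nth x0 l i.-1)).
have zl : z \in l.
  by rewrite -(mem_rotation i); apply: nbr_in => //; rewrite r0.
have iz : (i < index z l)%N.
  rewrite ltnNge; apply/negP => zle.
  have zi' : (index z l < i)%N.
    rewrite ltn_neqAle zle andbT.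
    by apply: contraNneq zi => <-; rewrite nth_index.
  have z1' : index z l != i.-1.
    apply/eqP => e; move: lz; rewrite -(nth_index x0 zl) e.
    by rewrite adj_irrefl.
  have z2' : index z l != i.-2.
    by apply: contraNneq z2 => <-; rewrite nth_index.
  (* If [z] came before [i], the rotated path, again a longest one, would have a first chord to a
     position below [i]. *)
  have /minQ : Q (i.-1 - index z l)%N.
    have e : (i.-1 - (i.-1 - index z l) = index z l)%N by clear -zi'; lia.
    have b : (1 < i.-1 - index z l < n)%N by clear -zi' z1' z2' iN; lia.
    have b' : (i.-1 - index z l < i <= size l)%N by rewrite nl; clear -zi' iN; lia.
    apply/asboolP; exists (rotation i l); split; [exact: pr|exact: nr|exact: b|].
    by rewrite r0 (nth_rotation _ b') e nth_index.
  by clear -i1; lia.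
exists (nth x0 l), n, i, (index y l), (index z l); split.
- move=> a b; rewrite !inE -nl => al bl /eqP.
  by rewrite nth_uniq // => /eqP.
- by move=> a an; apply: sl; rewrite nl.
- by rewrite i1 ij -nl !index_mem.
- by rewrite !nth_index.
Qed.

End MinimumDegree.

(** * A vertex of degree at most two *)

Section SmallDegree.
Variables (R : realType) (G : sgraph).

Lemma linked_in_sym (B : {set G}) x y : linked_in B x y = linked_in B y x.
Proof.
apply: sym_connect_sym => {}x {}y; rewrite /= /linked eq_sym adj_sym.
by rewrite andbCA.
Qed.

Lemma linked_in_adj (B : {set G}) x y : x \in B -> y \in B -> adj x y ->
  linked_in B x y.
Proof. by move=> xB yB xy; apply: connect1; rewrite /= xB yB /linked xy orbT. Qed.

Lemma linked_in_segment (B : {set G}) (v : nat -> G) a b : (a <= b)%N ->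
    (forall l, (a <= l <= b)%N -> v l \in B) ->
    (forall l, (a <= l < b)%N -> adj (v l) (v l.+1)) ->
  linked_in B (v a) (v b).
Proof.
move=> ab hB; elim: b ab hB => [|b IH] ab hB hv.
  by have -> : a = 0%N; [lia|exact: connect0].
have [e|ne] := eqVneq a b.+1; first by rewrite e; exact: connect0.
apply: connect_trans (IH _ _ _) _.
- lia.
- by move=> l lb; apply: hB; lia.
- by move=> l lb; apply: hv; lia.
- by apply: linked_in_adj; [apply: hB|apply: hB|apply: hv]; lia.
Qed.

(** If all degrees were at least 3, the path with chords from [min_degree3_chords] would contain a
    subdivided $K_4$. *)
Lemma outerplanar_small_degree : outerplanar R G -> (0 < #|G|)%N ->
  exists x : G, (degree x <= 2)%N.
Proof.
move=> op G0; apply: contrapT => no.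
have deg3 (x : G) : (2 < degree x)%N.
  by rewrite ltnNge; apply/negP => dx; apply: no; exists x.
have [v [k [i [j [m [inj pth [/andP[i1 ij] jk im mk] [vi vj vm]]]]]]] :=
  min_degree3_chords deg3 G0.
pose t := minn j m.
have [it tj tm] : [/\ i < t, t <= j & t <= m]%N by rewrite /t; split; clear -ij im; lia.
(* The branch vertices 1 to 4 sit at positions 0, [i - 1], [i] and [t]; the entry at index 0 is a
   dummy. *)
pose idx a := nth 0%N [:: 0; 0; i.-1; i; t]%N a.
(* Positions used by each subdivided edge: 12 and 34 follow the path, 13 is the first chord and 23 a
   path edge. 14 and 24 take the chords to [j] and [m] and run back along the path to [t]; one of
   them arrives at once because [t] is the minimum. *)
pose I a b l := match a, b with
  | 1, 2 => l < i | 3, 4 => i <= l <= t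
  | 1, 3 => (l == 0) || (l == i) | 2, 4 => (l == i.-1) || (t <= l <= m)
  | 1, 4 => (l == 0) || (t <= l <= j) | 2, 3 => (l == i.-1) || (l == i)
  | _, _ => false end%N.
pose B a b := [set x | [exists l : 'I_k, (x == v l) && I a b l]]%SET.
have inB a b l : (l < k)%N -> (v l \in B a b) = I a b l.
  move=> lk; rewrite inE; apply/existsP/idP => [[l' /andP[/eqP]]|Il].
    by move/inj; rewrite !inE ltn_ord lk => -> //.
  by exists (Ordinal lk); rewrite eqxx.
have BI a b x : x \in B a b -> exists2 l, (l < k)%N & x = v l /\ I a b l.
  by rewrite inE => /existsP[l /andP[/eqP -> Il]]; exists l.
have clean : (1 < i < t)%N /\ (t <= j < k)%N /\ (t <= m < k)%N.
  by rewrite i1 it tj tm jk mk.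
have idxk a : (idx a < k)%N.
  rewrite /idx; move: clean; clear; case: a => [|[|[|[|[|a]]]]] [] /=; try lia.
  by rewrite nth_nil; lia.
apply: (@outerplanar_K4_subdivision_free R G (v \o idx) B op).
- have inI a b l : I a b l -> (l < k)%N.
    move: clean; clear; rewrite /I.
    by case: a => [|[|[|[|a]]]]; case: b => [|[|[|[|[|b]]]]] //= []; lia.
  have seg a b l l' : (l <= l')%N -> (forall r, (l <= r <= l')%N -> I a b r) ->
      linked_in (B a b) (v l) (v l').
    move=> ll hI; have l'k : (l' < k)%N by apply: inI; apply: hI; rewrite ll /=.
    apply: linked_in_segment => // r hr.
      by rewrite inB; [exact: hI|lia].
    by apply: pth; lia.
  have edge a b l l' : I a b l -> I a b l' -> adj (v l) (v l') ->
      linked_in (B a b) (v l) (v l').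
    by move=> Il Il'; apply: linked_in_adj; rewrite inB // ?(inI _ _ _ Il) // (inI _ _ _ Il').
  have vi1 : adj (v i.-1) (v i).
    have e : i = i.-1.+1 by lia.
    by rewrite {2}e; apply: pth; lia.
  move=> a b ab b5; rewrite /= inB //.
  have [e|[e|[e|[e|[e|e]]]]] : (a, b) = (1, 2) \/ (a, b) = (1, 3) \/
      (a, b) = (1, 4) \/ (a, b) = (2, 3) \/ (a, b) = (2, 4) \/ (a, b) = (3, 4)%N.
    move: ab b5; clear; case: a => [|[|[|[|a]]]]; case: b => [|[|[|[|[|b]]]]] //=; tauto.
  + case: e => -> ->; split; first by rewrite /I /idx /=; lia.
    by apply: seg => [|r]; rewrite /I /idx /=; lia.
  + by case: e => -> ->; split; rewrite ?/I //; apply: edge; rewrite /I //= eqxx orbT.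
  + case: e => -> ->; split; first by rewrite /I.
    apply: (connect_trans (edge 1%N 4%N 0%N j _ _ vj)) => //.
      by rewrite /I; apply/orP; right; lia.
    rewrite -/(linked_in _ _ _) linked_in_sym; apply: seg => // r rj.
    by rewrite /I; apply/orP; right.
  + case: e => -> ->; split; first by rewrite /I /idx /= eqxx.
    by apply: edge; rewrite /I /idx /= ?eqxx ?orbT.
  + case: e => -> ->; split; first by rewrite /I /idx /= eqxx.
    apply: (connect_trans (edge 2%N 4%N i.-1 m _ _ vm)) => //.
    * by rewrite /I eqxx.
    * by rewrite /I; apply/orP; right; lia.
    rewrite -/(linked_in _ _ _) linked_in_sym; apply: seg => // r rj.
    by rewrite /I; apply/orP; right.
  + case: e => -> ->; split; first by rewrite /I /idx /=; lia.
    by apply: seg; [apply: ltnW|].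
- move=> a b c ab b5 c5 cab; rewrite /= inB //.
  move: clean ab b5 c5 cab; clear; rewrite /idx /I !inE.
  case: a => [|[|[|[|a]]]]; case: b => [|[|[|[|[|b]]]]] //;
  case: c => [|[|[|[|[|c]]]]] //= []; lia.
- move=> a b c d ab b5 cd d5 uq x /BI[l lk [-> Il]]; rewrite inB //.
  move: clean ab b5 cd d5 uq Il; clear; rewrite /I.
  case: a => [|[|[|[|a]]]]; case: b => [|[|[|[|[|b]]]]] //;
  case: c => [|[|[|[|c]]]] //; case: d => [|[|[|[|[|d]]]]] //= []; lia.
Qed.

End SmallDegree.

(** * Isomorphisms and components *)

Section Isomorphism.
Implicit Types G H : sgraph.

Lemma iso_of_inj_surj G H (f : H -> G) : injective f ->
    (forall x y, adj (f x) (f y) = adj x y) -> (forall y, exists x, f x = y) ->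
  isomorphic G H.
Proof.
move=> inj hadj /choice[g gK]; exists g; split; last first.
  by move=> x y; rewrite -hadj !gK.
by exists f => // x; apply: inj; rewrite gK.
Qed.

Lemma iso_of_inj_card G H (f : H -> G) : injective f ->
    (forall x y, adj (f x) (f y) = adj x y) -> (#|G| <= #|H|)%N ->
  isomorphic G H.
Proof.
move=> inj hadj card; apply: (iso_of_inj_surj inj hadj) => y.
by have [g _ gK] := inj_card_bij inj card; exists (g y).
Qed.

Lemma iso_card G H : isomorphic G H -> #|G| = #|H|.
Proof. by move=> [f [/bij_eq_card]]. Qed.

Lemma iso_degree G H (f : G -> H) (x : G) : bijective f ->
  (forall x y, adj (f x) (f y) = adj x y) -> degree (f x) = degree x.
Proof.
move=> [g fK gK] fadj; have inj := can_inj fK.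
rewrite /degree -[RHS](fintype.card_image inj); apply: eq_card => y.
by rewrite -(gK y) fintype.mem_image // !inE fadj.
Qed.

End Isomorphism.

Section Components.
Variable G : sgraph.
Implicit Types x y : G.

Lemma connect_adj_sym : connect_sym (@adj G).
Proof. exact: sym_connect_sym (@adj_sym G). Qed.

Lemma connect_closed (P : G -> Prop) x y :
    P x -> (forall u v, P u -> adj u v -> P v) -> connect adj x y -> P y.
Proof.
move=> Px hP /connectP[s + ->] {y}; elim: s x Px => //= z s IH x Px /andP[xz].
by apply: IH; apply: hP xz.
Qed.

(** A model of the component of each vertex is given; keeping those of the canonical roots counts
    each component once. *)
Lemma iso_components (K : G -> sgraph) (g : forall x, K x -> G) :
    (forall x, injective (g x)) ->
    (forall x a b, adj (g x a) (g x b) = adj a b) ->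
    (forall x y, connect adj x y <-> exists a, g x a = y) ->
  exists t (r : 'I_t -> G), isomorphic G (dunion_graph (fun i => K (r i))).
Proof.
move=> inj hadj himg; pose r (i : 'I_#|roots (@adj G)|) := enum_val i.
exists _, r.
have rK i : fingraph.root adj (r i) = r i by apply/eqP; apply: (enum_valP i).
have gr i a : fingraph.root adj (g (r i) a) = r i.
  rewrite -[RHS]rK; apply/eqP; rewrite (root_connect connect_adj_sym).
  by rewrite connect_adj_sym; apply/himg; exists a.
have same i j a b : connect adj (g (r i) a) (g (r j) b) -> i = j.
  rewrite -(root_connect connect_adj_sym) !gr => /eqP.
  exact: enum_val_inj.
pose f (u : dunion_graph (fun i => K (r i))) : G := g (r (tag u)) (tagged u).
apply: (@iso_of_inj_surj _ _ f).
- move=> [i a] [j b]; rewrite /f /= => e.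
  have ij : i = j by apply: (same _ _ a b); rewrite e connect0.
  by subst j; rewrite (inj _ _ _ e).
- move=> [i a] [j b]; rewrite /f /= /dunion_adj /=.
  have [ij|ij] := eqVneq i j.
    by subst j; rewrite tagged_asE hadj.
  by apply: contraNF ij => /connect1/same ->.
- move=> y; have rt := roots_root connect_adj_sym y.
  have : connect adj (fingraph.root adj y) y by rewrite connect_adj_sym connect_root.
  pose i := enum_rank_in rt (fingraph.root adj y).
  have <- : r i = fingraph.root adj y by rewrite /r enum_rankK_in.
  by move=> /himg[a ya]; exists (Tagged (fun i => K (r i)) a).
Qed.

(** The map to the unique neighbour is an involution without fixed points, and its orbits are the
    components. *)
Lemma regular1_iso : (forall x, degree x = 1%N) ->
  exists s, isomorphic G (copies s (complete_graph 2)).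
Proof.
move=> reg.
have /choice[m hm] x : exists y, forall z, adj x z = (z == y).
  by have [y hy] := mem_card1 (reg x); exists y => z; have := hy z; rewrite !inE.
have mK x : m (m x) = x by apply/eqP; rewrite eq_sym -hm adj_sym hm.
have mN x : m x != x.
  have := hm x (m x); rewrite eqxx; apply: contraTneq => {1}->.
  by rewrite adj_irrefl.
pose g x (i : complete_graph 2) := if i == ord0 then x else m x.
have ord2 (i : 'I_2) : i != ord0 -> i = ord_max.
  by move=> i0; apply/val_inj; case: i i0 => [[|[|]]].
have [||| t [r hr]] := @iso_components (fun=> complete_graph 2) g; last by exists t.
- move=> x i j; rewrite /g; case: (eqVneq i ord0) => [->|/ord2 ->];
    case: (eqVneq j ord0) => [->|/ord2 ->] //= /eqP.
    by rewrite eq_sym (negbTE (mN x)).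
  by rewrite (negbTE (mN x)).
- move=> x i j; rewrite /g /= /complete_adj hm.
  case: (eqVneq i ord0) => [->|/ord2 ->].
    by case: (eqVneq j ord0) => [_|_]; rewrite ?eqxx // eq_sym (negbTE (mN x)).
  by case: (eqVneq j ord0) => [->|/ord2 ->]; rewrite mK ?eqxx ?(negbTE (mN x)).
- move=> x y; split=> [|[i <-]].
    apply: (connect_closed (P := fun y => exists i, g x i = y)).
      by exists ord0; rewrite /g eqxx.
    move=> u v [i <-]; rewrite /g hm => /eqP ->; case: eqVneq => i0.
      by exists ord_max.
    by exists ord0; rewrite eqxx mK.
  rewrite /g; case: eqVneq => _; first exact: connect0.
  by apply: connect1; rewrite hm.
Qed.

End Components.

Lemma ordSE m (i : 'I_m) : val (ordS i) = if i == m.-1 :> nat then 0%N else i.+1.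
Proof.
have := ltn_ord i; rewrite /=; case: eqP => [->|im] lt.
  by rewrite prednK ?modnn; lia.
by rewrite modn_small; lia.
Qed.

Lemma cycle_adjE m (i j : 'I_m) : (3 <= m)%N ->
  cycle_adj i j = [|| j == i.+1 :> nat, i == j.+1 :> nat,
    (i == 0%N :> nat) && (j == m.-1 :> nat) |
    (j == 0%N :> nat) && (i == m.-1 :> nat)].
Proof.
move=> m3; rewrite /cycle_adj -!(inj_eq val_inj).
rewrite !ordSE /=; have := ltn_ord i; have := ltn_ord j.
move: (nat_of_ord i) (nat_of_ord j) => a b; clear -m3.
by case: (eqVneq a m.-1) => ?; case: (eqVneq b m.-1) => ? ? ?; lia.
Qed.

(** * Two-regular graphs as unions of cycles *)

Section TwoRegular.
Variable G : sgraph.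
Implicit Types x y : G.
Hypothesis reg : forall x, degree x = 2%N.

(** Next vertex of a walk that comes from [p] to [c] and does not turn back. The default [c] does
    not occur when [p] and [c] are adjacent, because [c] has degree 2. *)
Definition other_nbr (p c : G) : G := odflt c [pick y | adj c y && (y != p)].

Lemma other_nbrP p c : adj c p ->
  [/\ adj c (other_nbr p c), other_nbr p c != p &
      forall z, adj c z -> z = p \/ z = other_nbr p c].
Proof.
move=> cp; have /eqP := reg c; rewrite /degree -cardsE => /cards2P[a [b [ab E]]].
have adjE z : adj c z = (z == a) || (z == b).
  by have /finset.setP/(_ z) := E; rewrite !inE.
rewrite /other_nbr; case: pickP => [y /andP[cy yp]|no] /=.
  split=> // z; move: cp cy yp; rewrite !adjE.
  by move=> /orP[]/eqP-> /orP[]/eqP-> + /orP[]/eqP->; rewrite ?eqxx //; tauto.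
have := no a; have := no b; rewrite !adjE !eqxx orbT /=.
by move=> /negbFE/eqP bp /negbFE/eqP ap; rewrite ap bp eqxx in ab.
Qed.

(** A walk from [x] that never turns back first repeats a vertex by returning to its start. The
    vertices up to then form a cycle that is closed under adjacency, hence the whole component. *)
Lemma two_regular_cycle x : exists m (g : 'I_m -> G),
  [/\ (3 <= m)%N, injective g, forall i j, adj (g i) (g j) = cycle_adj i j &
      forall y, connect adj x y <-> exists i, g i = y].
Proof.
have [y0 xy0] : exists y, adj x y.
  by have /card_gt0P[y] : (0 < degree x)%N; [rewrite reg|rewrite inE; exists y].
pose pr n := iter n (fun p : G * G => (p.2, other_nbr p.1 p.2)) (x, y0).
pose w n := (pr n).1.
have wS n : w n.+2 = other_nbr (w n) (w n.+1) by [].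
have wadj n : adj (w n) (w n.+1).
  elim: n => // n IH; rewrite wS.
  by have [] := @other_nbrP (w n) (w n.+1); rewrite // adj_sym.
have wN n : w n.+2 != w n.
  by rewrite wS; have [] := @other_nbrP (w n) (w n.+1); rewrite // adj_sym.
have wnbr n z : adj (w n.+1) z -> z = w n \/ z = w n.+2.
  by rewrite wS; have [] := @other_nbrP (w n) (w n.+1); rewrite 1?adj_sym // => _ _; apply.
have wne n : w n.+1 != w n.
  by apply/eqP => e; have := wadj n; rewrite e adj_irrefl.
pose rep k := [exists j : 'I_k, w k == w j].
(* Otherwise more than [#|G|] vertices would be distinct. *)
have exrep : exists k, rep k.
  apply: contrapT => no; have : injective (fun i : 'I_#|G|.+1 => w i).
    move=> i j e; apply/val_inj.
    have [ij|ij|//] := ltngtP i j; exfalso; apply: no.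
      by exists j; apply/existsP; exists (Ordinal ij); rewrite e.
    by exists i; apply/existsP; exists (Ordinal ij); rewrite -e.
  by move/leq_card; rewrite card_ord ltnn.
case: (ex_minnP exrep) => k /existsP[j /eqP wkj] mink.
have winj a b : (a < k)%N -> (b < k)%N -> w a = w b -> a = b.
  move=> ak bk e; have [ab|ab|//] := ltngtP a b; exfalso.
    have : rep b by apply/existsP; exists (Ordinal ab); rewrite e.
    by move/mink; rewrite leqNgt bk.
  have : rep a by apply/existsP; exists (Ordinal ab); rewrite -e.
  by move/mink; rewrite leqNgt ak.
have jk := ltn_ord j.
(* If [j] were positive, [w k.-1] would be one of the two walk neighbours of [w j], which gives an
   earlier repetition, a loop or a step back. *)
have j0 : nat_of_ord j = 0%N.
  apply/eqP; apply: contraT; rewrite -lt0n => j0; exfalso.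
  have kS : k = k.-1.+1 by lia.
  have jS : nat_of_ord j = j.-1.+1 by lia.
  have : adj (w j) (w k.-1) by rewrite -wkj adj_sym {2}kS wadj.
  rewrite {1}jS => /wnbr[e|e]; first by have := winj _ _ _ _ e; lia.
  have {}e : w k.-1 = w j.+1 by rewrite e jS.
  have [ek|nk] := eqVneq k j.+1.
    by have := wne k.-1; rewrite -kS e -ek eqxx.
  have ek : k.-1 = j.+1 by apply: winj => //; clear -nk jk j0; lia.
  have ej : k = j.+2 by clear -ek kS; lia.
  by have := wN j; rewrite -ej wkj eqxx.
have k3 : (3 <= k)%N.
  rewrite ltnNge; apply/negP => k2; have := wne 0; have := wN 0.
  move: wkj; rewrite j0; move: k2 jk {mink winj}; case: k j j0 => [|[|[|]]] //.
    by move=> ? _ _ _ ->; rewrite eqxx.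
  by move=> ? _ _ _ ->; rewrite eqxx.
have wk0 : w k = w 0 by rewrite wkj j0.
have kS : k = k.-1.+1 by lia.
(* [w 1] is a neighbour of [w k = w 0] other than [w k.-1], so the walk goes round the cycle
   again. *)
have w1 : w 1 = w k.+1.
  have : adj (w k) (w 1) by rewrite wk0.
  rewrite kS => /wnbr[e|]; last by rewrite -kS.
  by have := winj _ _ _ _ e; lia.
have nbr a z : (a < k)%N -> adj (w a) z -> exists2 b, (b < k)%N & z = w b /\
    [|| b == a.+1, a == b.+1, (a == 0) && (b == k.-1) | (b == 0) && (a == k.-1)]%N.
  case: a => [_|a ak].
    rewrite -wk0 kS => /wnbr[->|]; first by exists k.-1; [lia|split=> //; lia].
    by rewrite -kS -w1 => ->; exists 1%N => //; lia.
  move=> /wnbr[->|->]; first by exists a; [lia|split=> //; lia].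
  have [aS|aS] := eqVneq a.+2 k.
    by exists 0%N; [lia|split; [rewrite aS|lia]].
  by exists a.+2; [lia|split=> //; lia].
exists k, (fun i : 'I_k => w i); split=> //.
- by move=> a b /winj e; apply/val_inj/e.
- move=> a b; rewrite cycle_adjE //; apply/idP/idP.
    by move=> /nbr[|c ck [/winj -> //]].
  case/or4P => [/eqP->|/eqP->|/andP[/eqP-> /eqP->]|/andP[/eqP-> /eqP->]].
  + exact: wadj.
  + by rewrite adj_sym wadj.
  + by rewrite -wk0 adj_sym {2}kS wadj.
  + by rewrite -wk0 {2}kS wadj.
- move=> y; split=> [|[i <-]].
    apply: (connect_closed (P := fun y => exists i : 'I_k, w i = y)).
      by exists (Ordinal (ltnW (ltnW k3))).
    by move=> u v [i <-] /nbr[//|b bk [-> _]]; exists (Ordinal bk).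
  elim: (nat_of_ord i) => [|n IH]; first exact: connect0.
  exact: connect_trans IH (connect1 (wadj n)).
Qed.

Lemma two_regular_iso : disjoint_union_of_cycles G.
Proof.
have /choice[c hc] x : exists c : {m & 'I_m -> G},
    [/\ (3 <= tag c)%N, injective (tagged c),
     forall i j, adj (tagged c i) (tagged c j) = cycle_adj i j &
     forall y, connect adj x y <-> exists i, tagged c i = y].
  by have [m [g h]] := two_regular_cycle x; exists (Tagged (fun m => 'I_m -> G) g).
have [|||t [r hr]] := @iso_components G (fun x => cycle_graph (tag (c x)))
  (fun x => tagged (c x)); try by move=> x; have [] := hc x.
by exists t, (fun i => tag (c (r i))); split=> // i; have [] := hc (r i).
Qed.

End TwoRegular.

(** * From outerplanarity to the list *)

Section ForwardDirection.

(** Two non-adjacent vertices of different degrees form an irregular independent set, and every such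
    set with at least two elements contains such a pair. Singletons give the lower bound. *)
Lemma alpha_ir1P (G : sgraph) : (0 < #|G|)%N ->
  alpha_ir G = 1%N <-> forall x y : G, ~~ adj x y -> degree x = degree y.
Proof.
move=> /card_gt0P[x0 _]; split=> [a1 x y nxy|twin].
  apply/eqP; apply: contraT => dxy.
  have xy : x != y by apply: contraNneq dxy => ->.
  have : (#|[set x; y]%SET| <= alpha_ir G)%N.
    apply: leq_bigmax_cond; apply/andP; split.
      apply/forall_inP => a; rewrite !inE => /orP[]/eqP->;
        apply/forall_inP => b; rewrite !inE => /orP[]/eqP->;
        by rewrite ?adj_irrefl // adj_sym.
    apply/forall_inP => a; rewrite !inE => /orP[]/eqP->;
      apply/forall_inP => b; rewrite !inE => /orP[]/eqP->;
      by rewrite ?eqxx //; apply/implyP => _; rewrite // eq_sym.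
  by rewrite cards2 xy a1.
apply/eqP; rewrite eqn_leq; apply/andP; split; last first.
  rewrite -(cards1 x0); apply: leq_bigmax_cond; apply/andP; split.
    apply/forall_inP => a /finset.set1P ->.
    by apply/forall_inP => b /finset.set1P ->; rewrite adj_irrefl.
  apply/forall_inP => a /finset.set1P ->.
  by apply/forall_inP => b /finset.set1P ->; rewrite eqxx.
apply/bigmax_leqP => A /andP[/forall_inP iA /forall_inP rA].
apply/card_le1_eqP => x y xA yA; apply/eqP; apply: contraT => xy.
have /forall_inP/(_ y yA)/twin e := iA x xA.
by have /forall_inP/(_ y yA) := rA x xA; rewrite eq_sym xy e eqxx.
Qed.

Variable G : sgraph.
Implicit Types x y u v w : G.

Lemma nbrs_leq x (A : {set G}) : {in A, forall y, adj x y} -> (#|A| <= degree x)%N.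
Proof.
by move=> h; apply: subset_leq_card; apply/fintype.subsetP => y /h; rewrite inE.
Qed.

Lemma nbrs_eq x (A : {set G}) : {in A, forall y, adj x y} ->
  (degree x <= #|A|)%N -> forall y, adj x y = (y \in A).
Proof.
move=> h dA y; have : A \subset [pred y | adj x y].
  by apply/fintype.subsetP => z /h; rewrite inE.
move/subset_leqif_card => [_]; rewrite eqn_leq -/(degree x) dA nbrs_leq //.
by move=> /esym/fintype.subsetP hA; apply/idP/idP => [xy|/h //]; apply: hA; rewrite inE.
Qed.

Lemma edgeless_iso : (forall x y, ~~ adj x y) -> isomorphic G (edgeless_graph #|G|).
Proof.
move=> no; apply: (@iso_of_inj_card _ (edgeless_graph #|G|) (@enum_val G G)).
- exact: enum_val_inj.
- by move=> x y; apply/negbTE.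
- by rewrite card_ord.
Qed.

Lemma star_iso u : (forall x y, adj x y = (x == u) (+) (y == u)) ->
  isomorphic G (complete_bipartite_graph 1 #|G|.-1).
Proof.
move=> hadj; have cu : #|G|.-1 = #|predC1 u| by rewrite [RHS]cardC1.
pose f (a : complete_bipartite_graph 1 #|G|.-1) : G :=
  match a with inl _ => u | inr i => enum_val (cast_ord cu i) end.
have fu i : (f (inr i) == u) = false.
  by apply/negbTE; have := enum_valP (cast_ord cu i); rewrite inE.
apply: (@iso_of_inj_card _ _ f).
- move=> [i|i] [j|j].
  + by rewrite (ord1 i) (ord1 j).
  + by move/esym/eqP; rewrite fu.
  + by move/eqP; rewrite fu.
  + by move=> /enum_val_inj/cast_ord_inj ->.
- by move=> [i|i] [j|j]; rewrite hadj ?fu ?eqxx.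
- rewrite card_sum !card_ord add1n prednK //.
  by apply/card_gt0P; exists u.
Qed.

Section MinusVertex.
Variable u : G.
Definition minus_adj : rel {x : G | x != u} := fun a b => adj (val a) (val b).
Lemma minus_sym : symmetric minus_adj.
Proof. by move=> x y; apply: adj_sym. Qed.
Lemma minus_irrefl : irreflexive minus_adj.
Proof. by move=> x; apply: adj_irrefl. Qed.
Definition minus_vertex := SGraph minus_sym minus_irrefl.

Lemma minus_degree (x : minus_vertex) : adj (val x) u ->
  degree (val x) = (degree x).+1.
Proof.
move=> xu; rewrite /degree [LHS](cardD1 u) inE xu add1n; congr _.+1.
rewrite -[RHS](fintype.card_image val_inj); apply: eq_card => y; rewrite !inE.
apply/andP/fintype.imageP => [[yu xy]|[[z zu] xz ->]]; first by exists (exist _ y yu).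
by split.
Qed.

Lemma apex_iso (H : sgraph) : (forall x, x != u -> adj u x) ->
    isomorphic minus_vertex H ->
  isomorphic G (join_graph (complete_graph 1) H).
Proof.
move=> hu [g [[h gK hK] gadj]].
pose f (a : join_graph (complete_graph 1) H) : G :=
  match a with inl _ => u | inr t => val (h t) end.
have fu t : f (inr t) != u by apply: (valP (h t)).
apply: (@iso_of_inj_surj _ _ f).
- move=> [i|x] [j|y].
  + by rewrite (ord1 i) (ord1 j).
  + by move/esym/eqP; rewrite (negbTE (fu y)).
  + by move/eqP; rewrite (negbTE (fu x)).
  + by move/val_inj/(can_inj hK) ->.
- move=> [i|x] [j|y] /=.
  + by rewrite adj_irrefl (ord1 i) (ord1 j) /complete_adj eqxx.
  + exact/hu/fu.
  + by rewrite adj_sym; apply/hu/fu.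
  + by rewrite -[RHS](congr2 (@adj H) (hK x) (hK y)) gadj.
- move=> y; have [->|yu] := eqVneq y u; first by exists (inl ord0).
  by exists (inr (g (exist _ y yu))); rewrite /f gK.
Qed.

End MinusVertex.

End ForwardDirection.

Lemma card_copies2 s : #|copies s (complete_graph 2)| = (s * 2)%N.
Proof.
rewrite card_tagged sumnE big_map big_enum /= sum_nat_const card_ord.
by rewrite card_ord.
Qed.

(** Let [d] be the minimum degree and [O] the set of vertices of other degrees; [O] is completely
    joined to its complement, so [#|O| <= d <= 2]. For [d = 0] there are no edges; for [d = 1],
    [#|O|] equal to 0 or 1 gives a matching or a star; for [d = 2], the values 0, 1, 2 give cycles,
    a windmill or $K_2 + E_2$. $K_{2,2}$ is covered as a 4-cycle. *)
Lemma outerplanar_alpha1 (R : realType) (G : sgraph) : (0 < #|G|)%N ->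
    outerplanar R G -> alpha_ir G = 1%N ->
  disjoint_union_of_cycles G \/
  isomorphic G (edgeless_graph #|G|) \/
  (~~ odd #|G| /\ isomorphic G (copies #|G|./2 (complete_graph 2))) \/
  isomorphic G (complete_bipartite_graph 1 #|G|.-1) \/
  isomorphic G (join_graph (complete_graph 2) (edgeless_graph 2)) \/
  (odd #|G| /\ (2 <= #|G|.-1./2)%N /\ isomorphic G (windmill 3 #|G|.-1./2)).
Proof.
move=> G0 op /(alpha_ir1P G0) twin.
have [x0 x0d] := outerplanar_small_degree op G0.
case: (arg_minnP (@degree G) (isT : predT x0)) => v _ minv.
have mind (x : G) : (degree v <= degree x)%N by apply: minv.
have dv : (degree v <= 2)%N := leq_trans (mind x0) x0d.
have adjd (x y : G) : degree x != degree y -> adj x y.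
  by apply: contraNT => /twin ->.
pose O := [set x : G | degree x != degree v]%SET.
have Oadj x y : x \in O -> y \notin O -> adj x y.
  rewrite !inE negbK => xO /eqP yO; apply: adjd; rewrite yO //.
have vO : v \notin O by rewrite inE eqxx.
have Ole : (#|O| <= degree v)%N.
  by apply: nbrs_leq => x xO; rewrite adj_sym; apply: Oadj.
have notO x : x \notin O -> degree x = degree v by rewrite inE negbK => /eqP.
have inO x : x \in O -> degree x != degree v by rewrite inE.
have regular : #|O| = 0%N -> forall x : G, degree x = degree v.
  by move=> O0 x; apply: notO; rewrite (cards0_eq O0) inE.
case dvE: (degree v) dv notO inO Ole regular mind => [|[|[|d]]] // _ notO inO.
- rewrite leqn0 => /eqP O0 /(_ O0) reg _; right; left; apply: edgeless_iso => x y.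
  apply/negP => xy; have : y \in pred0 by rewrite -(card0_eq (reg x)) inE.
  by [].
- case OE: #|O| => [|[|]] // _ reg _.
    have [s iso] := regular1_iso (reg erefl).
    have := iso_card iso; rewrite card_copies2 => nE.
    by right; right; left; rewrite nE muln2 odd_double doubleK.
  have /eqP/cards1P[u Ou] := OE.
  right; right; right; left; apply: (@star_iso _ u) => x y.
  have nbr z t : z != u -> adj z t = (t == u).
    move=> zu; rewrite (@nbrs_eq _ z [set u]%SET) ?inE //.
      by move=> a /finset.set1P ->; rewrite adj_sym; apply: Oadj; rewrite Ou !inE.
    by rewrite cards1 notO // Ou inE.
  have [->|xu] := eqVneq x u; last exact: nbr.
  have [->|yu] := eqVneq y u; first by rewrite adj_irrefl.
  by rewrite adj_sym nbr // eqxx.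
case OE: #|O| => [|[|[|]]] // _ reg mind.
- by left; apply: two_regular_iso; apply: reg.
- have /eqP/cards1P[u Ou] := OE.
  have hu x : x != u -> adj u x by move=> xu; apply: Oadj; rewrite Ou !inE.
  have [|s iso] := @regular1_iso (minus_vertex u).
    move=> [x xu]; apply/eq_add_S; rewrite -minus_degree /=.
      by rewrite notO // Ou inE.
    by rewrite adj_sym; apply: hu.
  have isoW : isomorphic G (windmill 3 s) by apply: apex_iso hu iso.
  have := iso_card isoW; rewrite card_sum card_ord card_copies2 add1n muln2 => nE.
  do 5!right; rewrite nE /= odd_double doubleK; split=> //; split=> //.
  (* [u] has degree [2 * s], which is positive and, as [u] lies in [O], different from 2. *)
  rewrite ltnNge; apply/negP => s1.
  have : degree u != 2%N by apply: inO; rewrite Ou inE.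
  have : (#|[set~ u]%SET| <= degree u)%N.
    by apply: nbrs_leq => x; rewrite !inE; apply: hu.
  have : (degree u <= #|[set~ u]%SET|)%N.
    apply: subset_leq_card; apply/fintype.subsetP => x; rewrite !inE => ux.
    by apply: contraTneq ux => ->; rewrite adj_irrefl.
  have : (0 < degree u)%N.
    by apply/card_gt0P; exists v; rewrite inE; apply: Oadj; rewrite // Ou inE.
  by rewrite cardsC1 nE -muln2; move: s1; clear; lia.
have /eqP/cards2P[u [w [uw Ou]]] := OE.
have uO : u \in O by rewrite Ou !inE eqxx.
have wO : w \in O by rewrite Ou !inE eqxx orbT.
have nbr x t : x \notin O -> adj x t = (t \in O).
  move=> xO; apply: nbrs_eq; last by rewrite OE notO.
  by move=> y yO; rewrite adj_sym; apply: Oadj.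
(* Three vertices outside [O] would form a $K_{2,3}$ with [u] and [w]. *)
have CO2 : (#|~: O| <= 2)%N.
  rewrite leqNgt; apply/negP => /card_gt2P[x [y [z [[xO yO zO] [xy yz zx]]]]].
  apply: (@outerplanar_K23_free R G [:: u; w] [:: x; y; z] op erefl erefl).
    rewrite !finset.in_setC in xO yO zO.
    have neq a b : a \in O -> b \notin O -> a != b.
      by move=> aO; apply: contraNneq => <-.
    rewrite /= !inE !negb_or uw xy yz [x == z]eq_sym zx.
    by rewrite !(neq u) ?(neq w).
  rewrite !finset.in_setC in xO yO zO.
  have sub a b : a \in O -> b \notin O -> adj a b by apply: Oadj.
  by move=> a b; rewrite !inE => /orP[]/eqP-> /or3P[]/eqP->; apply: Oadj.
have nE : (#|G| = 2 + #|~: O|)%N by rewrite -OE cardsC.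
(* A vertex of [O] has degree at least 3 in a graph with at most 4 vertices, so there are exactly 4
   and it is adjacent to all others. *)
have d3 x : x \in O -> [/\ #|~: O| = 2%N & forall y, y != x -> adj x y].
  move=> /inO dx.
  have dx3 : (3 <= degree x)%N.
    by have := mind x; move: dx; clear; lia.
  have Dx : (degree x <= #|[set~ x]%SET|)%N.
    apply: subset_leq_card; apply/fintype.subsetP => y; rewrite !inE => xy.
    by apply: contraTneq xy => ->; rewrite adj_irrefl.
  move: (Dx); rewrite cardsC1 nE => Dx'; have C2 : #|~: O| = 2%N by lia.
  split=> // y yx.
  have : [pred y | adj x y] \subset [set~ x]%SET.
    apply/fintype.subsetP => z; rewrite !inE => xz.
    by apply: contraTneq xz => ->; rewrite adj_irrefl.
  move/subset_leqif_card => [_]; rewrite eqn_leq Dx /= cardsC1 nE C2 dx3.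
  by move=> /esym/fintype.subsetP/(_ y); rewrite !inE; apply.
have [C2 adju] := d3 u uO; have [_ adjw] := d3 w wO.
have eO : 2%N = #|O| by rewrite OE.
have eC : 2%N = #|~: O| by rewrite C2.
pose f (t : join_graph (complete_graph 2) (edgeless_graph 2)) : G :=
  match t with inl i => enum_val (cast_ord eO i)
             | inr i => enum_val (cast_ord eC i) end.
have fO i : f (inl i) \in O by apply: enum_valP.
have fC i : f (inr i) \notin O by rewrite -finset.in_setC; apply: enum_valP.
have OC i j : f (inl i) <> f (inr j) by move=> e; move: (fC j); rewrite -e fO.
do 4!right; left; apply: (@iso_of_inj_card _ _ f).
- move=> [i|i] [j|j].
  + by move=> /enum_val_inj/cast_ord_inj ->.
  + by move/OC.
  + by move/esym/OC.
  + by move=> /enum_val_inj/cast_ord_inj ->.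
- move=> [i|i] [j|j].
  + rewrite /= /complete_adj; have [->|ij] := eqVneq i j.
      by rewrite adj_irrefl.
    have [_] := d3 _ (fO i); apply; apply: contra ij.
    by rewrite eq_sym => /eqP/enum_val_inj/cast_ord_inj ->.
  + by rewrite Oadj.
  + by rewrite adj_sym Oadj.
  + by rewrite nbr // (negbTE (fC j)).
- by rewrite card_sum !card_ord nE C2.
Qed.

(** * Drawings on a parabola *)

Section ConvexDrawing.
Variables (R : realType) (G : sgraph) (f : G -> nat).
Notation plane := (R * R)%type.
Hypothesis f_inj : injective f.
Hypothesis f_noncrossing : forall a b c d : G,
  (f a < f b < f c)%N -> (f c < f d)%N -> adj a c -> adj b d -> False.

Let co x : R := (f x)%:R.
Let parabola_pt x : plane := (co x, co x ^+ 2).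
Let chord x y : set plane := segment (parabola_pt x) (parabola_pt y) @` `[0, 1].

Let co_inj : injective co.
Proof. by move=> x y /eqP; rewrite eqr_nat => /eqP/f_inj. Qed.

Let parabola_pt_inj : injective parabola_pt.
Proof. by move=> x y [/co_inj]. Qed.

Let chordC x y : chord x y = chord y x.
Proof.
suff sub a b : chord a b `<=` chord b a by apply/seteqP; split; apply: sub.
move=> _ [t /= + <-]; rewrite in_itv /= => /andP[t0 t1].
exists (1 - t); first by rewrite /= in_itv /=; apply/andP; split; lra.
by rewrite /segment /=; congr pair; ring.
Qed.

(** On the chord, [p.2 - p.1 ^+ 2] equals [(p.1 - co x) * (co y - p.1)]; this turns incidences of
    chords into polynomial inequalities. *)
Let chordP x y p : chord x y p ->
  p.2 = (co x + co y) * p.1 - co x * co y /\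
  0 <= (p.1 - co x) * (co y - p.1).
Proof.
move=> [t /= + <-]; rewrite in_itv /= => /andP[t0 t1].
split; first by rewrite /segment /=; ring.
have -> : (co x + t * (co y - co x) - co x) * (co y - (co x + t * (co y - co x))) =
    t * (1 - t) * (co y - co x) ^+ 2 by ring.
by rewrite mulr_ge0 ?sqr_ge0 // mulr_ge0 // subr_ge0.
Qed.

Let chord_arc x y : adj x y -> is_arc (parabola_pt x) (parabola_pt y) (chord x y).
Proof.
move=> xy; exists (segment (parabola_pt x) (parabola_pt y)); split=> //.
- exact/continuous_subspaceT/segment_continuous.
- move=> s t _ _ [/addrI/mulIf + _]; apply.
  rewrite subr_eq0; apply/eqP => /co_inj e.
  by rewrite e adj_irrefl in xy.
- by rewrite /segment !mul0r !addr0.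
- by rewrite /segment !mul1r !subrKC.
Qed.

Let chord_vertex x y z : adj x y -> chord x y (parabola_pt z) -> z \in [:: x; y].
Proof.
move=> _ /chordP[/= h _]; have : (co z - co x) * (co y - co z) = 0.
  have -> : (co z - co x) * (co y - co z) =
    (co x + co y) * co z - co x * co y - co z ^+ 2 by ring.
  by rewrite -h subrr.
move=> /eqP; rewrite mulf_eq0 !subr_eq0 !(inj_eq co_inj) !inE eq_sym.
by case/orP => /eqP ->; rewrite eqxx ?orbT.
Qed.

Let chord_cross_lt x y x' y' p : (f x < f y)%N -> (f x' < f y')%N ->
    adj x y -> adj x' y' -> (x, y) != (x', y') ->
    chord x y p -> chord x' y' p -> range parabola_pt p.
Proof.
move=> xy xy' axy axy' ne /chordP[e1 h1] /chordP[e2 h2].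
have on z : p.1 = co z -> p.2 = co z ^+ 2 -> range parabola_pt p.
  by move=> p1 p2; exists z => //; case: p p1 p2 {e1 h1 e2 h2} => a b /= -> ->.
have [ex|nx] := eqVneq p.1 (co x); first by apply: (on x) => //; rewrite e1 ex; ring.
have [ey|ny] := eqVneq p.1 (co y); first by apply: (on y) => //; rewrite e1 ey; ring.
have [ex'|nx'] := eqVneq p.1 (co x'); first by apply: (on x') => //; rewrite e2 ex'; ring.
have [ey'|ny'] := eqVneq p.1 (co y'); first by apply: (on y') => //; rewrite e2 ey'; ring.
exfalso; have co_lt a b : (f a < f b)%N = (co a < co b) by rewrite ltr_nat.
have between a b : co a < co b -> p.1 != co a -> p.1 != co b ->
    0 <= (p.1 - co a) * (co b - p.1) -> co a < p.1 < co b.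
  move=> ab na nb h; apply/andP; split; rewrite lt_neqAle 1?eq_sym ?na ?nb /=;
    rewrite leNgt; apply/negP => lt; have : 0 < (co b - p.1) * (p.1 - co a).
  - by nra.
  - by nra.
  - by nra.
  - by nra.
rewrite !co_lt in xy xy'.
have /andP[b1 b2] := between _ _ xy nx ny h1.
have /andP[b3 b4] := between _ _ xy' nx' ny' h2.
(* Both products are the height of [p] above the parabola. Equal heights exclude nested intervals, a
   common abscissa excludes disjoint ones, and interleaved ones contradict [f_noncrossing]. *)
have E : (p.1 - co x) * (co y - p.1) = (p.1 - co x') * (co y' - p.1).
  have -> : (p.1 - co x) * (co y - p.1) = p.2 - p.1 ^+ 2 by rewrite e1; ring.
  by rewrite e2; ring.
have [xx|xx|/co_inj xx] := ltrgtP (co x) (co x').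
- have [yy|yy|yy] := ltrgtP (co y) (co y'); [|nra|nra].
  by apply: (@f_noncrossing x x' y y'); rewrite ?co_lt // xx /=; lra.
- have [yy|yy|yy] := ltrgtP (co y) (co y'); [nra| |nra].
  by apply: (@f_noncrossing x' x y' y); rewrite ?co_lt // xx /=; lra.
- subst x'; have [yy|yy|/co_inj yy] := ltrgtP (co y) (co y'); [nra|nra|].
  by rewrite yy eqxx in ne.
Qed.

Let chord_cross x y x' y' : adj x y -> adj x' y' ->
    (x', y') \notin [:: (x, y); (y, x)] ->
  chord x y `&` chord x' y' `<=` range parabola_pt.
Proof.
have adj_ne a b : adj a b -> (f a < f b)%N \/ (f b < f a)%N.
  move=> ab; have [|//|e] := ltngtP (f a) (f b); [by left|by right|].
  by rewrite (f_inj e) adj_irrefl in ab.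
move=> xy xy'; rewrite !inE negb_or !xpair_eqE => /andP[n1 n2] p [].
have ne a b c d : ~~ ((a == c) && (b == d)) -> (c, d) != (a, b) :> G * G.
  by rewrite xpair_eqE ![c == _]eq_sym ![d == _]eq_sym.
case: (adj_ne _ _ xy) => h; case: (adj_ne _ _ xy') => h'.
- by apply: chord_cross_lt => //; apply: ne.
- rewrite [chord x' _]chordC; apply: chord_cross_lt; rewrite // 1?adj_sym //.
  by apply: ne; rewrite andbC.
- rewrite [chord x _]chordC; apply: chord_cross_lt; rewrite // 1?adj_sym //.
  exact: ne.
- rewrite chordC [chord x' _]chordC; apply: chord_cross_lt; rewrite // 1?adj_sym //.
  by apply: ne; rewrite andbC.
Qed.

Definition convex_drawing : plane_drawing R G :=
  PlaneDrawing parabola_pt_inj (fun x y _ => chordC x y) chord_arc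
    chord_vertex chord_cross.

Let below : set plane := [set p | p.2 < p.1 ^+ 2].

Let below_support : below `<=` ~` drawing_support convex_drawing.
Proof.
move=> p; rewrite /below /= => hp [[x _ px]|[x [y [_ /chordP[e h]]]]].
  by move: hp; rewrite -px /= ltxx.
by move: hp e h; nra.
Qed.

(* [below] is swept by the arcs of parabola through [(0, -1)]. *)
Let below_connected : connected below.
Proof.
pose g (p : plane) (t : R) : plane := (t * p.1, t * t * (p.2 + 1) - 1).
have -> : below = \bigcup_(p in below) g p @` `[0, 1].
  apply/seteqP; split=> [p hp|_ [p hp [t /= + <-]]].
    exists p => //; exists 1; first by rewrite /= in_itv /= lexx ler01.
    by rewrite /g !mul1r addrK; case: p {hp}.
  rewrite in_itv /= => /andP[t0 t1]; rewrite /below /= in hp *.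
  have [->|tn0] := eqVneq t 0; first by rewrite !mul0r expr0n /=; lra.
  have t2 : 0 < t * t by rewrite mulr_gt0 // lt_neqAle eq_sym tn0.
  have : t * t * p.2 < t * t * p.1 ^+ 2 by rewrite ltr_pM2l.
  nra.
apply: bigcup_connected.
  exists (0, -1) => p _; exists 0; first by rewrite /= in_itv /= lexx ler01.
  by rewrite /g !mul0r add0r.
move=> p _; apply: connected_continuous_connected; first exact: segment_connected.
apply: continuous_subspaceT; apply: pair_continuous => t.
  by apply: cvgM; [exact: cvg_id|exact: cvg_cst].
apply: (@cvgD R R R (nbhs t) _ (fun t => t * t * (p.2 + 1)) (fun=> - 1)).
  by apply: cvgM; [apply: cvgM; exact: cvg_id|exact: cvg_cst].
exact: cvg_cst.
Qed.

(** The region below the parabola is connected, unbounded and free of the drawing, and it touches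
    every vertex; the face containing it is the required one. *)
Lemma noncrossing_outerplanar : outerplanar R G.
Proof.
pose q : plane := (0, -1).
have qb : below q by rewrite /below /= expr0n /=; lra.
pose F := connected_component (~` drawing_support convex_drawing) q.
have bF : below `<=` F.
  exact: (connected_component_max qb below_support below_connected).
exists convex_drawing, F; split.
- by exists q => //; apply: below_support.
- move=> [M [_ hM]]; pose N : R := `|M| + 1.
  have MN : M < N by rewrite /N; have := ler_norm M; lra.
  have N1 : 0 < N by rewrite /N; have := normr_ge0 M; lra.
  have := hM N MN (0, - (N + 1)) (bF _ _).
  rewrite /below /= expr0n /= => h.
  have /h : - (N + 1) < 0 by lra.
  rewrite /Num.norm /= ge_max => /andP[_].
  by rewrite normrN ger0_norm; lra.
- move=> x; split.
    (* The point half a radius below the vertex lies under the parabola. *)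
    move=> B /nbhs_ballP[r /= r0 hr]; exists (co x, co x ^+ 2 - r / 2); split.
      by apply: bF; rewrite /below /=; lra.
    apply: hr; apply/plane_ballE => /=; rewrite subrr normr0; split=> //.
    by rewrite opprB addrC subrK gtr0_norm; lra.
  move=> /interior_subset/connected_component_sub; apply.
  by left; exists x.
Qed.

End ConvexDrawing.

(** * Noncrossing orders and degrees for the listed graphs *)

Section ConvexOrders.
Implicit Types G H : sgraph.

Definition noncrossing G (f : G -> nat) := forall a b c d : G,
  (f a < f b < f c)%N -> (f c < f d)%N -> adj a c -> adj b d -> False.

(** The strengthening of [noncrossing] that survives, as [noncrossing], the addition of an apex in
    front of all vertices. *)
Definition straight G (f : G -> nat) := forall a b c : G,
  (f a < f b < f c)%N -> adj a c -> False.

Lemma straight_noncrossing G (f : G -> nat) : straight f -> noncrossing f.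
Proof. by move=> h a b c d abc _ ac _; exact: h abc ac. Qed.

Section Dunion.
Variables (t : nat) (H : 'I_t -> sgraph) (f : forall i, H i -> nat).

Lemma dunion_adj_tag (u v : dunion_graph H) : adj u v -> tag u = tag v.
Proof. by move=> /andP[/eqP]. Qed.

Let bound := \max_(u : {i & H i}) (f (tagged u)).+1.

(** The components occupy consecutive blocks of numbers; [bound] exceeds every label, so the tag
    dominates. *)
Definition lex_order (u : dunion_graph H) : nat := tag u * bound + f (tagged u).

Let lt_bound (u : dunion_graph H) : (f (tagged u) < bound)%N.
Proof. exact: (leq_bigmax (F := fun u : {i & H i} => (f (tagged u)).+1) u). Qed.

Lemma lex_order_tag (u v : dunion_graph H) :
  (lex_order u <= lex_order v)%N -> (tag u <= tag v)%N.
Proof.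
have := lt_bound u; have := lt_bound v; rewrite /lex_order => hv hu.
apply: contraLR; rewrite -!ltnNge => vu.
apply: (@leq_trans (tag u * bound)); last exact: leq_addr.
apply: leq_trans (leq_mul vu (leqnn bound)).
by rewrite mulSn addnC ltn_add2r.
Qed.

Lemma lex_order_inj : (forall i, injective (@f i)) -> injective lex_order.
Proof.
move=> inj u v e.
have tuv : tag u = tag v.
  by apply/val_inj/eqP; rewrite eqn_leq !lex_order_tag ?e.
case: u v tuv e => [i x] [j y] /= ij; subst j.
by rewrite /lex_order /= => /addnI/inj ->.
Qed.

(** The ends of an edge share a block, so interleaved edges lie in one and the same component. *)
Lemma lex_order_noncrossing :
  (forall i, noncrossing (@f i)) -> noncrossing lex_order.
Proof.
move=> hf a b c d /andP[ab bc] cd ac bd.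
have := dunion_adj_tag ac; have := dunion_adj_tag bd => tbd tac.
have tab : tag a = tag b.
  apply/val_inj/eqP; rewrite eqn_leq (lex_order_tag (ltnW ab)) tac.
  by rewrite (lex_order_tag (ltnW bc)).
case: a b c d tbd tac tab ab bc cd ac bd => [i x] [j y] [k z] [l w] /=.
move=> jl ik ij; subst k j l.
rewrite /lex_order /= !ltn_add2l /dunion_adj /= !eqxx !tagged_asE /=.
by move=> xy yz; apply: (hf i x y z w); rewrite xy.
Qed.

Lemma lex_order_straight : (forall i, straight (@f i)) -> straight lex_order.
Proof.
move=> hf a b c /andP[ab bc] ac.
have tac := dunion_adj_tag ac.
have tab : tag a = tag b.
  apply/val_inj/eqP; rewrite eqn_leq (lex_order_tag (ltnW ab)) tac.
  by rewrite (lex_order_tag (ltnW bc)).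
case: a b c tac tab ab bc ac => [i x] [j y] [k z] /= ik ij; subst k j.
rewrite /lex_order /= !ltn_add2l /dunion_adj /= !eqxx !tagged_asE /=.
by move=> xy yz; apply: (hf i x y z); rewrite xy.
Qed.

Lemma dunion_degree (u : dunion_graph H) : degree u = degree (tagged u).
Proof.
case: u => i x; rewrite /degree /=.
have inj : injective (fun y : H i => Tagged H y).
  by move=> y z /eqP; rewrite eq_Tagged => /eqP.
rewrite -[RHS](fintype.card_image inj); apply: eq_card => -[j y]; rewrite !inE.
rewrite /dunion_adj /=; apply/andP/fintype.imageP => [[/eqP ij]|[z xz e]].
  by subst j; rewrite tagged_asE => xy; exists y.
have ji : j = i by case: e.
by subst j; move/eqP: e; rewrite eq_Tagged /= => /eqP ->; rewrite tagged_asE eqxx.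
Qed.

End Dunion.

Lemma cycle_noncrossing m : (3 <= m)%N ->
  noncrossing (fun i : cycle_graph m => nat_of_ord i).
Proof.
move=> m3 a b c d ab cd; rewrite /= !cycle_adjE //.
have := ltn_ord d; move: ab cd; clear -m3.
by move: (nat_of_ord a) (nat_of_ord b) (nat_of_ord c) (nat_of_ord d); lia.
Qed.

Lemma cycle_degree m (i : cycle_graph m) : (3 <= m)%N -> degree i = 2%N.
Proof.
(* For [m >= 3] neither one nor two successor steps return to the start, so successor and
   predecessor are two distinct neighbours. *)
move=> m3; have ne (j : 'I_m) : ordS j != j /\ ordS (ordS j) != j.
  rewrite -!(inj_eq val_inj) !ordSE; have := ltn_ord j; move: m3; clear.
  by case: (eqVneq (val j) m.-1) => /= ?; rewrite ?eqxx; case: ifP; lia.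
have predN : ordS i != ord_pred i.
  by have [_] := ne (ord_pred i); rewrite ord_predK.
rewrite /degree (eq_card (B := pred2 (ordS i) (ord_pred i))) ?card2 ?predN //.
move=> j; rewrite !inE /= /cycle_adj -[i == ordS j](can2_eq (@ord_predK m) (@ordSK m)).
rewrite [ord_pred i == j]eq_sym andb_idl // => h; apply/eqP => ij; subst j.
have [n1 _] := ne i; have [n2 _] := ne (ord_pred i).
rewrite ord_predK in n2; move: h n1 n2.
by rewrite [i == ordS i]eq_sym; case/orP => ->.
Qed.

Lemma complete_degree r (i : complete_graph r) : degree i = r.-1.
Proof.
rewrite -[r in RHS]card_ord -(cardC1 i); apply: eq_card => j; rewrite !inE.
by rewrite /= /complete_adj eq_sym.
Qed.

Lemma complete2_straight : straight (fun i : complete_graph 2 => nat_of_ord i).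
Proof. by move=> a b c /= /andP[ab bc]; have := ltn_ord c; lia. Qed.

Lemma join_degree_inr G H (y : H) :
  @degree (join_graph G H) (inr y) = (#|G| + degree y)%N.
Proof.
rewrite /degree -!sum1_card big_sumType /= sum1_card.
by congr addn.
Qed.

(** An edge at the apex starts at position 0, so it can only be crossed by an edge of [H] passing
    over its other end. *)
Lemma join_apex_noncrossing H (f : H -> nat) : straight f ->
  noncrossing (fun u : join_graph (complete_graph 1) H =>
    if u is inr y then (f y).+1 else 0%N).
Proof.
move=> hf a b c d; case: b => [j|b].
  by case: a.
case: c => [k|c]; first by rewrite /= andbF.
case: d => [l|d] // /andP[_ /= bc] /= cd _.
by apply: (hf b c d); rewrite ltnS in bc; rewrite bc.
Qed.

(** Reduces each graph of the list to a noncrossing vertex order and a comparison of degrees. *)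
Lemma outerplanar_alpha1_iso (R : realType) G H (f : H -> nat) :
    (0 < #|G|)%N -> isomorphic G H -> injective f -> noncrossing f ->
    (forall x y : H, ~~ adj x y -> degree x = degree y) ->
  outerplanar R G /\ alpha_ir G = 1%N.
Proof.
move=> G0 [g [gb gadj]] inj nc twin; split.
  apply: (@noncrossing_outerplanar R G (f \o g)).
    exact: inj_comp inj (bij_inj gb).
  by move=> a b c d ab cd; rewrite -!gadj; apply: nc.
apply/(alpha_ir1P G0) => x y; rewrite -gadj => /twin.
by rewrite !(iso_degree _ gb gadj).
Qed.

Lemma twins_degree H :
    (forall x y : H, ~~ adj x y -> adj x =1 adj y) ->
  forall x y : H, ~~ adj x y -> degree x = degree y.
Proof. by move=> h x y /h xy; apply: eq_card => z; rewrite !inE. Qed.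

Lemma bipartite_twins p q (x y : complete_bipartite_graph p q) :
  ~~ adj x y -> adj x =1 adj y.
Proof. by move: x y => [i|i] [j|j] // _ [k|k]. Qed.

Lemma star_noncrossing p :
  noncrossing (fun u : complete_bipartite_graph 1 p =>
    if u is inr j then j.+1 else 0%N).
Proof. by move=> a [j|b] c [l|d] /andP[ab bc] //=; case: a ab. Qed.

(* Opposite corners of the square drawn at 0, 1, 2, 3. *)
Definition square_order p q (u : 'I_p + 'I_q) : nat :=
  match u with inl i => i.*2 | inr j => j.*2.+1 end.

Lemma square_order_inj p q : injective (@square_order p q).
Proof.
by move=> [i|i] [j|j] /= e; try (congr (_ _); apply/val_inj => /=); lia.
Qed.

Lemma square_order_corners (a b c d : 'I_2 + 'I_2) :
    (square_order a < square_order b < square_order c)%N ->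
    (square_order c < square_order d)%N ->
  [/\ a = inl ord0, b = inr ord0, c = inl ord_max & d = inr ord_max].
Proof.
move: a b c d => [a|a] [b|b] [c|c] [d|d] /= ab cd;
  have := ltn_ord a; have := ltn_ord b; have := ltn_ord c; have := ltn_ord d;
  move=> d2 c2 b2 a2; try (exfalso; lia).
by split; congr (_ _); apply/val_inj => /=; lia.
Qed.

End ConvexOrders.

(* Both directions of the characterization *)
Local Close Scope ring_scope.
Local Close Scope classical_set_scope.

Theorem corollary3p6 (R : realType) (G : sgraph) (n : nat)
    (card_G : #|G| = n) (n_gt0 : 0 < n) :
  (outerplanar R G /\ alpha_ir G = 1) <->
  (disjoint_union_of_cycles G \/
   isomorphic G (edgeless_graph n) \/
   (~~ odd n /\ isomorphic G (copies n./2 (complete_graph 2))) \/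
   isomorphic G (complete_bipartite_graph 1 n.-1) \/
   isomorphic G (complete_bipartite_graph 2 2) \/
   isomorphic G (join_graph (complete_graph 2) (edgeless_graph 2)) \/
   (odd n /\ 2 <= n.-1./2 /\ isomorphic G (windmill 3 n.-1./2))).
Proof.
subst n; split=> [[op a1]|].
  by have := outerplanar_alpha1 n_gt0 op a1; tauto.
have iso := @outerplanar_alpha1_iso R G _ _ n_gt0.
case=> [[t [m [m3 h]]]|[h|[[_ h]|[h|[h|[h|[_ [_ h]]]]]]]].
- apply: (iso _ (lex_order (fun i (x : cycle_graph (m i)) => nat_of_ord x)) h).
  + by apply: lex_order_inj => i; apply: ord_inj.
  + by apply: lex_order_noncrossing => i; apply: cycle_noncrossing.
  + by move=> x y _; rewrite !dunion_degree !cycle_degree.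
- apply: (iso _ (fun i : edgeless_graph _ => nat_of_ord i) h).
  + exact: ord_inj.
  + by move=> a b c d _ _ /=.
  + by apply: twins_degree.
- apply: (iso _ (lex_order (fun i (x : complete_graph 2) => nat_of_ord x)) h).
  + by apply: lex_order_inj => i; apply: ord_inj.
  + apply/straight_noncrossing/lex_order_straight => i.
    exact: complete2_straight.
  + by move=> x y _; rewrite !dunion_degree !complete_degree.
- apply: (iso _ _ h _ (@star_noncrossing _)).
  + by move=> [i|i] [j|j] //= => [_|[/ord_inj->//]]; rewrite (ord1 i) (ord1 j).
  + exact/twins_degree/bipartite_twins.
- apply: (iso (complete_bipartite_graph 2 2) (@square_order 2 2) h).
  + exact: square_order_inj.
  (* Crossing edges would be the two diagonals of the square, but the ends of the first lie in the
     same partite set. *)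
  + by move=> a b c d ab cd; have [-> _ -> _] := square_order_corners ab cd.
  + exact/twins_degree/bipartite_twins.
- apply: (iso (join_graph (complete_graph 2) (edgeless_graph 2))
    (@square_order 2 2) h).
  + exact: square_order_inj.
  (* Here one diagonal is the edge of $K_2$, while the other joins the two vertices of $E_2$ and is
     absent. *)
  + by move=> a b c d ab cd _; have [_ -> _ ->] := square_order_corners ab cd.
  + apply: twins_degree => -[i|i] [j|j] //=.
    by rewrite /complete_adj negbK => /eqP ->.
(* The disjoint edges are laid out one after the other, and the hub is placed before them. *)
- have st := @lex_order_straight #|G|.-1./2 _ _ (fun=> complete2_straight).
  apply: (iso _ _ h _ (join_apex_noncrossing st)).
  + move=> [i|x] [j|y] //= => [_|[]]; first by rewrite (ord1 i) (ord1 j).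
    by move=> e; congr inr; apply: lex_order_inj e => i; apply: ord_inj.
  + move=> [i|x] [j|y] // nadj; first by rewrite (ord1 i) (ord1 j).
    by rewrite !join_degree_inr !dunion_degree !complete_degree.
Qed.
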